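(* Let $f\colon M\to M$ be a real Anosov diffeomorphism. If $\gamma\colon[a,b]\to M$ is a pw$C^1$ stable curve, then its stable $\widehat\rho$-length $\ell^s_{\widehat\rho}(\gamma)$ is well-defined (that is, $0<\ell^s_{\widehat\rho}(\gamma)<+\infty$) and $$\ell^s_{\widehat\rho}(\gamma)=\int_a^b\widehat\rho(\gamma(t),\gamma'(t))\,dt.$$ Also, if $\eta\colon[a,b]\to M$ is a pw$C^1$ unstable curve, then its unstable $\widehat\rho$-length $\ell^u_{\widehat\rho}(\eta)$ is well-defined (that is, $0<\ell^u_{\widehat\rho}(\eta)<+\infty$) and $$\ell^u_{\widehat\rho}(\eta)=\int_a^b\widehat\rho(\eta(t),\eta'(t))\,dt.$$
   Context: $M$ is a closed, connected, smooth manifold with Riemannian metric $\|\cdot\|$ (norm $\|\cdot\|_x$ on $T_xM$) and induced distance $d$. $f$ is Anosov: there are a $Df$-invariant splitting $TM=E^s\oplus E^u$ and constants $c>0$, $\lambda_0\in(0,1)$ with $\|Df^n|_{E^s}\|\le c\lambda_0^n$, $\|Df^{-n}|_{E^u}\|\le c\lambda_0^n$ for all $n\in\mathbb{N}$. $f$ is real Anosov: moreover there is a continuous decomposition into $Df$-invariant one-dimensional sub-bundles $E^s=E^s_1\oplus\dots\oplus E^s_k$, $E^u=E^u_1\oplus\dots\oplus E^u_l$ and numbers $0<|a_1|\le\dots\le|a_k|<1<|b_1|\le\dots\le|b_l|$ with $\|Df(x)v\|_{f(x)}=|a_i|\|v\|_x$ for $v\in E^s_i(x)$ and $\|Df^{-1}(x)v\|_{f^{-1}(x)}=|b_j^{-1}|\|v\|_x$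 for $v\in E^u_j(x)$. Let $\lambda=\max\{|a_i^{-1}|,|b_j|: 1\le i\le k,\ 1\le j\le l\}>1$. For $(x,v)\in TM$ write $v=\sum_i v^s_i+\sum_j v^u_j$ with $v^s_i\in E^s_i(x)$, $v^u_j\in E^u_j(x)$, and set $$\rho(x,v)=\max_{i,j}\left\{\|v^s_i\|_x^{\log\lambda/\log|a_i^{-1}|},\ \|v^u_j\|_x^{\log\lambda/\log|b_j|}\right\},\qquad \widehat\rho(x,v)=\inf\{\mu>0:\rho(x,v/\mu)\le1\}.$$ $W^s(x)=\{y: d(f^n(y),f^n(x))\to0,\ n\to\infty\}$ and $W^u(x)=\{y: d(f^n(y),f^n(x))\to0,\ n\to-\infty\}$; a stable (unstable) curve is a continuous curve contained in a single stable (unstable) set. A curve is pw$C^1$ (piecewise $C^1$) if it is continuous and there is a partition of its domain such that its restriction to each piece is regular and $C^1$. For $y\in W^s(x)$, $d^s_{\widehat\rho}(x,y)$ is the infimum of $\int_a^b\widehat\rho(\gamma(t),\gamma'(t))\,dt$ over all pw$C^1$ stable curves $\gamma\colon[a,b]\to M$ with $\gamma(a)=x$, $\gamma(b)=y$; for $y\in W^u(x)$, $d^u_{\widehat\rho}(x,y)$ is defined in the same way with pw$C^1$ unstable curves. For $\sigma=s$ and $\gamma\colon[a,b]\to M$ a stable curve (resp. $\sigma=u$ and $\gamma$ an unstable curve), $\ell^\sigma_{\widehat\rho}(\gamma)=\sup_P\sum_{i=0}^{n-1}d^\sigma_{\widehat\rho}(\gamma(a_{i+1}),\gamma(a_i))$,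 the supremum being over all partitions $P=\{a=a_0<a_1<\dots<a_n=b\}$ of $[a,b]$. *)

(* Defs.v *)
From HB Require Import structures.
From mathcomp Require Import all_boot all_order all_algebra.
From mathcomp Require Import all_classical all_reals all_analysis.
Import Order.TTheory GRing.Theory Num.Theory.
Import numFieldNormedType.Exports.

Set Implicit Arguments.
Unset Strict Implicit.
Unset Printing Implicit Defensive.

Local Open Scope classical_set_scope.
Local Open Scope ring_scope.

Fixpoint Ck (R : realType) (V W : normedModType R) (k : nat) (U : set V)
    (F : V -> W) : Prop :=
  if k is k'.+1 then
    (forall p, U p -> differentiable F p) /\
    (forall v, Ck k' U ('D_v F))
  else forall p, U p -> {for p, continuous F}.

Definition Cinfty (R : realType) (V W : normedModType R) (U : set V)
  (F : V -> W) : Prop := forall k, Ck k U F.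

(* [chart i] and [chart_inv i] are only meaningful on [dom i] and on
   [chart i @` dom i] respectively. These images are open in R^n, so there is
   no boundary. *)
Record smoothManifold (R : realType) (n : nat) (M : topologicalType) := {
  chart_index : Type;
  dom : chart_index -> set M;
  chart : chart_index -> M -> 'rV[R]_n;
  chart_inv : chart_index -> 'rV[R]_n -> M;
  chart_at : M -> chart_index;
  manifold_hausdorff : hausdorff_space M;
  manifold_second_countable : @second_countable M;
  dom_open : forall i, open (dom i);
  codom_open : forall i, open (chart i @` dom i);
  chartK : forall i x, dom i x -> chart_inv i (chart i x) = x;
  chart_continuous : forall i, {within dom i, continuous (chart i)};
  chart_inv_continuous :
    forall i, {within chart i @` dom i, continuous (chart_inv i)};
  dom_chart_at : forall x, dom (chart_at x) x;
  transition_smooth : forall i j,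
    Cinfty (chart i @` (dom i `&` dom j)) (chart j \o chart_inv i) }.

(* The tangent space at x is represented by 'rV[R]_n: a tangent vector at x is
   given by its coordinates in the preferred chart [chart_at X x]. *)
Section Manifold.
Context (R : realType) (n : nat) (M : topologicalType).
Context (X : smoothManifold R n M).

(* [tcoord i j x v] is the coordinate vector in chart j of the tangent vector
   at x whose coordinate vector in chart i is v. *)
Definition tcoord (i j : chart_index X) (x : M) (v : 'rV[R]_n) : 'rV[R]_n :=
  'd (chart j \o chart_inv i) (chart i x) v.

Definition continuous_field (U : set M) (Y : M -> 'rV[R]_n) : Prop :=
  forall i : chart_index X,
    {within U `&` dom i,
      continuous (fun y => tcoord (chart_at X y) i y (Y y))}.

Definition continuous_line_bundle (E : M -> {vspace 'rV[R]_n}) : Prop :=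
  (forall x, \dim (E x) = 1%N) /\
  (forall x, exists U, open_nbhs x U /\
    exists Y, continuous_field U Y /\ forall y, U y -> E y = <[Y y]>%VS).

Definition C1_map (f : M -> M) : Prop :=
  continuous f /\
  forall i j : chart_index X,
    Ck 1 (chart i @` (dom i `&` f @^-1` dom j))
      (chart j \o f \o chart_inv i).

Definition diffeomorphism (f finv : M -> M) : Prop :=
  [/\ cancel f finv, cancel finv f, C1_map f & C1_map finv].

Definition tmap (f : M -> M) (x : M) (v : 'rV[R]_n) : 'rV[R]_n :=
  'd (chart (chart_at X (f x)) \o f \o chart_inv (chart_at X x))
     (chart (chart_at X x) x) v.

Definition invariant_bundle (f : M -> M) (E : M -> {vspace 'rV[R]_n}) : Prop :=
  forall x, tmap f x @` [set` E x] = [set` E (f x)].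

Record riemannianMetric := {
  metric : M -> 'rV[R]_n -> 'rV[R]_n -> R;
  metric_sym : forall x u v, metric x u v = metric x v u;
  metric_linear : forall x w c u v,
    metric x (c *: u + v) w = c * metric x u w + metric x v w;
  metric_pos : forall x v, v != 0 -> 0 < metric x v v;
  metric_smooth : forall (i : chart_index X) (u v : 'rV[R]_n),
    Cinfty (chart i @` dom i)
      (fun p => let y := chart_inv i p in
         metric y (tcoord i (chart_at X y) y u)
                  (tcoord i (chart_at X y) y v) : R^o) }.

(* The restriction of g to the closed interval [p, q] is regular and C^1:
   derivatives are taken relatively to [p, q], hence are one-sided at p and
   q, and w is the velocity read in chart i. *)
Definition regular_C1 (g : R -> M) (p q : R) : Prop :=
  forall i : chart_index X, exists w : R -> 'rV[R]_n,
    forall t, t \in `[p, q] -> dom i (g t) ->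
    [/\ w t != 0,
        w u @[u --> within `[p, q] (nbhs t)] --> w t &
        (u - t)^-1 *: (chart i (g u) - chart i (g t))
          @[u --> within `[p, q] t^'] --> w t].

Definition pwC1_curve (a b : R) (g : R -> M) : Prop :=
  [/\ a < b, {within `[a, b], continuous g} &
      exists2 s, itv_partition a b s &
        forall j, (j < size s)%N ->
          regular_C1 g (nth b (a :: s) j) (nth b (a :: s) j.+1)].

(* For a pwC^1 curve this is a junk value at most at the endpoints and at the
   finitely many break points, which do not affect integrals. *)
Definition velocity (g : R -> M) (t : R) : 'rV[R]_n :=
  derive1 (chart (chart_at X (g t)) \o g) t.

Definition curve_integral (F : M -> 'rV[R]_n -> R) (a b : R) (g : R -> M)
    : \bar R :=
  (\int[lebesgue_measure]_(t in `[a, b]) (F (g t) (velocity g t))%:E)%E.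

Definition tnorm (G : riemannianMetric) (x : M) (v : 'rV[R]_n) : R :=
  Num.sqrt (metric G x v v).

Definition riemannian_dist (G : riemannianMetric) (x y : M) : \bar R :=
  ereal_inf [set e | exists a b g,
    [/\ pwC1_curve a b g, g a = x, g b = y &
        e = curve_integral (tnorm G) a b g]].

Definition stable_set (G : riemannianMetric) (f : M -> M) (x : M) : set M :=
  [set y | riemannian_dist G (iter m f y) (iter m f x) @[m --> \oo]
             --> 0%E].

Definition unstable_set (G : riemannianMetric) (finv : M -> M) (x : M)
  : set M := stable_set G finv x.

Definition anosov (G : riemannianMetric) (f finv : M -> M)
    (Es Eu : M -> {vspace 'rV[R]_n}) : Prop :=
  [/\ diffeomorphism f finv,
      invariant_bundle f Es /\ invariant_bundle f Eu,
      forall x, (Es x + Eu x)%VS = fullv /\ directv (Es x + Eu x) &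
      exists c lambda0 : R, [/\ 0 < c, 0 < lambda0 < 1,
        forall m x v, v \in Es x ->
          tnorm G (iter m f x) (tmap (iter m f) x v)
            <= c * lambda0 ^+ m * tnorm G x v &
        forall m x v, v \in Eu x ->
          tnorm G (iter m finv x) (tmap (iter m finv) x v)
            <= c * lambda0 ^+ m * tnorm G x v]].

Section RealAnosov.
Context (G : riemannianMetric) (k l : nat).
Context (Es : 'I_k -> M -> {vspace 'rV[R]_n}).
Context (Eu : 'I_l -> M -> {vspace 'rV[R]_n}).
Context (a : 'I_k -> R) (b : 'I_l -> R).

Definition real_anosov (f finv : M -> M) : Prop :=
  [/\ anosov G f finv (fun x => \sum_(i < k) Es i x)%VS
                      (fun x => \sum_(j < l) Eu j x)%VS,
      forall x, directv (\sum_(i < k) Es i x) /\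
                directv (\sum_(j < l) Eu j x),
      (forall i, continuous_line_bundle (Es i) /\ invariant_bundle f (Es i)) /\
      (forall j, continuous_line_bundle (Eu j) /\ invariant_bundle f (Eu j)),
      [/\ forall i, 0 < `|a i| < 1, forall j, 1 < `|b j|,
          {homo a : i i' / (i <= i')%N >-> `|i| <= `|i'|} &
          {homo b : j j' / (j <= j')%N >-> `|j| <= `|j'|}] &
      (forall i x v, v \in Es i x ->
         tnorm G (f x) (tmap f x v) = `|a i| * tnorm G x v) /\
      (forall j x v, v \in Eu j x ->
         tnorm G (finv x) (tmap finv x v) = `|(b j)^-1| * tnorm G x v)].

Definition lambda : R :=
  Num.max (\big[Num.max/0]_(i < k) `|(a i)^-1|)
          (\big[Num.max/0]_(j < l) `|b j|).

Definition components (x : M) (v : 'rV[R]_n)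
    : ('I_k -> 'rV[R]_n) * ('I_l -> 'rV[R]_n) :=
  xget (fun=> 0, fun=> 0)
    [set p | [/\ forall i, p.1 i \in Es i x, forall j, p.2 j \in Eu j x &
                 v = \sum_(i < k) p.1 i + \sum_(j < l) p.2 j]].

Definition rho (x : M) (v : 'rV[R]_n) : R :=
  Num.max
    (\big[Num.max/0]_(i < k)
       tnorm G x ((components x v).1 i) `^ (ln lambda / ln `|(a i)^-1|))
    (\big[Num.max/0]_(j < l)
       tnorm G x ((components x v).2 j) `^ (ln lambda / ln `|b j|)).

Definition rho_hat (x : M) (v : 'rV[R]_n) : R :=
  inf [set mu : R | 0 < mu /\ rho x (mu^-1 *: v) <= 1].

(* In what follows W is either [stable_set G f] or [unstable_set G finv]. *)
Definition curve_in (W : M -> set M) (p q : R) (g : R -> M) : Prop :=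
  {within `[p, q], continuous g} /\ exists x, g @` `[p, q] `<=` W x.

Definition rho_dist (W : M -> set M) (x y : M) : \bar R :=
  ereal_inf [set e | exists p q g,
    [/\ pwC1_curve p q g, curve_in W p q g, g p = x, g q = y &
        e = curve_integral rho_hat p q g]].

Definition rho_length (W : M -> set M) (p q : R) (g : R -> M) : \bar R :=
  ereal_sup [set e | exists2 s, itv_partition p q s &
    e = (\sum_(0 <= i < size s)
           rho_dist W (g (nth q (p :: s) i.+1)) (g (nth q (p :: s) i)))%E].

End RealAnosov.
End Manifold.

(* Main.v *)
(** In terms of the components of v the infimum defining rho_hat is just
    max {||v^s_i||, ||v^u_j||}, because the exponents in rho are positive. So
    rho_hat is a continuous Finsler norm: in a chart, |v A(y)| for a continuous
    field of invertible matrices A and the sup norm. No dynamics is involved in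
    the rest. A piece of the curve, run backwards, competes in the distance
    between its endpoints, so the length is at most the integral. Conversely,
    near a given point the norm is almost constant in a chart, so any competitor
    is at least (1 - epsilon) times as long as the chord, whatever set W it is
    confined to; and the chord is almost as long as the arc. Cousin's argument
    then produces a partition whose sum is within epsilon of the integral. *)

Require Import Defs.
From mathcomp Require Import all_boot all_order all_algebra.
From mathcomp Require Import all_classical all_reals all_analysis.
From mathcomp Require Import measurable_realfun ring lra.
Import Order.TTheory GRing.Theory Num.Theory.
Import numFieldNormedType.Exports.

Set Implicit Arguments.
Unset Strict Implicit.
Unset Printing Implicit Defensive.

Local Open Scope classical_set_scope.
Local Open Scope ring_scope.

(** * Charts and tangent coordinates *)

Section Charts.
Context (R : realType) (n : nat) (M : topologicalType).
Context (X : smoothManifold R n M).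
Implicit Types (i j : chart_index X) (x y : M) (v : 'rV[R]_n).

(** A tangent vector is stored by its coordinates in the preferred chart of its base point, and that
    chart may jump from point to point. A field of vectors or of norms is therefore never compared
    at two points as it stands, but only after transport by [tcoord] to one fixed chart. The line
    bundles are merely continuous, so the norm is compared with its value frozen at a point; the
    error is taken relative to the norm, which by homogeneity makes one neighbourhood serve for
    vectors of every size. The delicate point is that a competitor joining two nearby points is
    arbitrary and may leave the chart. Velocities may jump at the break points, so estimates near a
    point hold within one piece, and the partition is grown by one-sided steps rather than taken
    with a uniform mesh. Positivity of the length comes from the regularity of the pieces: the
    velocity vanishes nowhere. *)

Lemma nbhs_dom i x : dom i x -> nbhs x (dom i).
Proof. by move=> ix; apply: open_nbhs_nbhs; split => //; exact: dom_open. Qed.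

Lemma nbhs_codom i x : dom i x -> nbhs (chart i x) (chart i @` dom i).
Proof.
by move=> ix; apply: open_nbhs_nbhs; split; [exact: codom_open | exists x].
Qed.

Lemma chart_cvg i x : dom i x -> {for x, continuous (chart i)}.
Proof.
move=> ix; have := @chart_continuous _ _ _ X i.
rewrite continuous_open_subspace; last exact: dom_open.
by apply; rewrite inE.
Qed.

Lemma chart_inv_cvg i x : dom i x ->
  chart_inv i p @[p --> chart i x] --> x.
Proof.
move=> ix; have := @chart_inv_continuous _ _ _ X i.
rewrite continuous_open_subspace; last exact: codom_open.
move=> /(_ (chart i x)); rewrite inE /continuous_at chartK//.
by apply; exists x.
Qed.

Lemma chart_invK_near i x : dom i x ->
  \forall p \near chart i x, chart i (chart_inv i p) = p.
Proof.
move=> ix; near=> p.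
have [y iy <-] : (chart i @` dom i) p by near: p; exact: nbhs_codom.
by rewrite chartK.
Unshelve. all: by end_near. Qed.

Lemma transition_differentiable i j x : dom i x -> dom j x ->
  differentiable (chart j \o chart_inv i) (chart i x).
Proof.
move=> ix jx; have [+ _] := @transition_smooth _ _ _ X i j 1%N.
by apply; exists x.
Qed.

(** The two transition maps compose to the identity near [chart i x], so the chain rule applies. It
    allows any tangent vector to be presented as the transport of a vector read in a chosen
    chart. *)
Lemma tcoordK i j x v : dom i x -> dom j x ->
  tcoord j i x (tcoord i j x v) = v.
Proof.
move=> ix jx; rewrite /tcoord.
have fE : (chart j \o chart_inv i) (chart i x) = chart j x.
  by rewrite /= chartK.
have df := transition_differentiable ix jx.
have dg := transition_differentiable jx ix; rewrite -fE in dg.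
have := congr1 (fun h => h v) (diff_comp df dg); rewrite /= chartK// => <-.
rewrite -deriveE; last exact: differentiable_comp.
rewrite (near_eq_derive (g := id)) ?derive_id//.
near=> p => /=; rewrite [chart_inv j _]chartK.
  by near: p; exact: chart_invK_near.
near: p; apply: (chart_inv_cvg ix); exact: nbhs_dom.
Unshelve. all: by end_near. Qed.

Lemma tcoordB i j x u v : tcoord i j x (u - v) = tcoord i j x u - tcoord i j x v.
Proof. exact: linearB. Qed.

Lemma tcoordN i j x v : tcoord i j x (- v) = - tcoord i j x v.
Proof. exact: linearN. Qed.

Lemma tcoordZ i j x (c : R) v : tcoord i j x (c *: v) = c *: tcoord i j x v.
Proof. exact: linearZ. Qed.

Lemma tcoord_sum i j x (I : Type) (r : seq I) (P : pred I) (F : I -> 'rV[R]_n) :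
  tcoord i j x (\sum_(m <- r | P m) F m) =
  \sum_(m <- r | P m) tcoord i j x (F m).
Proof. exact: linear_sum. Qed.

End Charts.

(** * Velocities of regular curves *)

(** A chain rule along an arbitrary filter, so as to cover the one-sided quotients at the ends of a
    piece. The remainder is o([xi u - x]), and multiplying by [r u] keeps it small because
    [r u *: (xi u - x)] stays bounded by [|w| + 1]. *)
Lemma diff_quotient_cvg (R : realType) (V W : normedModType R) (F : set_system R)
    {FF : Filter F} (psi : V -> W) (xi : R -> V) (r : R -> R) (x w : V) :
  differentiable psi x -> xi @ F --> x ->
  r u *: (xi u - x) @[u --> F] --> w ->
  r u *: (psi (xi u) - psi x) @[u --> F] --> 'd psi x w.
Proof.
move=> dpsi xix rw.
have dpsiw : 'd psi x (r u *: (xi u - x)) @[u --> F] --> 'd psi x w.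
  by apply: continuous_cvg => //; exact: diff_continuous.
rewrite -[X in _ --> X]addr0.
rewrite (_ : (fun u => _) = (fun u => 'd psi x (r u *: (xi u - x)) +
    r u *: (psi (xi u) - psi x - 'd psi x (xi u - x)))); last first.
  by apply/funext => u; rewrite linearZ -scalerDr subrKC.
apply: cvgD => //; apply/cvgr0Pnorm_le => e e0.
have C0 : 0 < `|w| + 1 by rewrite ltr_wpDl.
have /eqaddoP /(_ (e / (`|w| + 1))) := diff_locally dpsi.
rewrite divr_gt0// => /(_ isT) near0.
have xix0 : xi u - x @[u --> F] --> (0 : V).
  by rewrite -(subrr x); apply: cvgB => //; exact: cvg_cst.
have {}near0 := xix0 _ near0.
have wlt : \forall u \near F, `|r u *: (xi u - x)| <= `|w| + 1.
  by apply: (cvgr_le _ (cvg_norm rw)); rewrite ltrDl.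
near=> u.
have : `|psi (xi u) - psi x - 'd psi x (xi u - x)|
    <= e / (`|w| + 1) * `|xi u - x|.
  have : `|(psi \o shift x - (cst (psi x) + 'd psi x)) (xi u - x)|
      <= e / (`|w| + 1) * `|xi u - x| by near: u.
  by rewrite /= !fctE /= subrK opprD addrA.
rewrite normrZ => /(ler_wpM2l (normr_ge0 (r u))) /le_trans; apply.
rewrite mulrCA -normrZ (@le_trans _ _ (e / (`|w| + 1) * (`|w| + 1)))//.
  by apply: ler_wpM2l; [exact: divr_ge0 (ltW e0) (ltW C0) | near: u].
by rewrite divfK// gt_eqF.
Unshelve. all: by end_near. Qed.

(** A nondegenerate segment accumulates at each of its points, ends included; hence relative
    derivatives are unique there. *)
Lemma within_segment_proper (R : realType) (c d t : R) : c < d -> t \in `[c, d] ->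
  ProperFilter (within `[c, d] t^').
Proof.
move=> cd; rewrite in_itv/= => /andP[ct td].
apply: Build_ProperFilter_ex => U /nbhs_ballP[e /= e0 eU].
have [tltd|dlet] := ltP t d.
- have m0 : 0 < Num.min (e / 2) (d - t) by rewrite lt_min subr_gt0 tltd divr_gt0.
  have m1 : Num.min (e / 2) (d - t) <= e / 2 by rewrite ge_min lexx.
  have m2 : Num.min (e / 2) (d - t) <= d - t by rewrite ge_min lexx orbT.
  exists (t + Num.min (e / 2) (d - t)); apply: eU => /=.
  + by rewrite /ball/= opprD addNKr normrN gtr0_norm//; lra.
  + by rewrite -subr_eq0 addrAC subrr add0r gt_eqF.
  + by rewrite in_itv/=; lra.
- have m0 : 0 < Num.min (e / 2) (t - c).
    by rewrite lt_min subr_gt0 (lt_le_trans cd)// divr_gt0.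
  have m1 : Num.min (e / 2) (t - c) <= e / 2 by rewrite ge_min lexx.
  have m2 : Num.min (e / 2) (t - c) <= t - c by rewrite ge_min lexx orbT.
  exists (t - Num.min (e / 2) (t - c)); apply: eU => /=.
  + by rewrite /ball/= opprB addrC subrK gtr0_norm//; lra.
  + by rewrite -subr_eq0 addrAC subrr add0r oppr_eq0 gt_eqF.
  + by rewrite in_itv/=; lra.
Qed.

Lemma is_derive_within (R : realType) (V : normedModType R) (f : R -> V)
    (c d t : R) (l : V) : t \in `]c, d[ ->
  (u - t)^-1 *: (f u - f t) @[u --> within `[c, d] t^'] --> l ->
  is_derive t 1 f l.
Proof.
move=> tcd ql.
suff fl : (fun h => h^-1 *: ((f \o shift t) (h *: 1) - f t)) @ 0^' --> l.
  by apply: DeriveDef; [exact: cvgP fl | exact: cvg_lim].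
move=> U /ql; rewrite /nbhs/= /within/= => near_t.
have near_cd : \forall u \near t, u \in `[c, d].
  by apply: filterS (near_in_itvoo tcd) => u; exact: subset_itv_oo_cc.
have : \forall u \near t, u != t -> U ((u - t)^-1 *: (f u - f t)).
  near=> u; move=> ut; suff : u != t -> `[c, d]%classic u -> U ((u - t)^-1 *: (f u - f t)).
    by apply => //=; near: u.
  by near: u.
rewrite (near_shift 0 t) => h; near=> z.
have : z + (t - 0) != t -> U ((z + (t - 0) - t)^-1 *: (f (z + (t - 0)) - f t)).
  by near: z; apply: nbhs_dnbhs.
rewrite subr0 addrK /= /GRing.scale/= mulr1; apply.
rewrite -subr_eq0 addrK; near: z; exact: nbhs_dnbhs_neq.
Unshelve. all: by end_near. Qed.

Section Pieces.
Context (R : realType) (n : nat) (M : topologicalType).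
Context (X : smoothManifold R n M).
Implicit Types (g : R -> M) (c d t : R) (i j : chart_index X).

(** The skolemized form of [regular_C1]: one family of velocities, indexed by the charts, that later
    statements can share. *)
Definition chart_velocity g c d (w : chart_index X -> R -> 'rV[R]_n) : Prop :=
  forall i t, t \in `[c, d] -> dom i (g t) ->
  [/\ w i t != 0,
      w i u @[u --> within `[c, d] (nbhs t)] --> w i t &
      (u - t)^-1 *: (chart i (g u) - chart i (g t))
        @[u --> within `[c, d] t^'] --> w i t].

Lemma regular_C1_velocity g c d : regular_C1 X g c d ->
  exists w, chart_velocity g c d w.
Proof. by move=> /choice[w wP]; exists w => i t; exact: wP. Qed.

Lemma curve_near g c d t (U : set M) : {within `[c, d], continuous g} ->
  t \in `[c, d] -> nbhs (g t) U -> \forall u \near within `[c, d] (nbhs t), U (g u).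
Proof. by move=> /subspace_continuousP cg tcd; exact: cg. Qed.

Lemma within_dnbhsW (A : set R) t : within A t^' `=>` within A (nbhs t).
Proof. by move=> U; rewrite /within/= => /nbhs_dnbhs. Qed.

Lemma chart_curve_cvg g c d i t : {within `[c, d], continuous g} ->
  t \in `[c, d] -> dom i (g t) ->
  chart i (g u) @[u --> within `[c, d] (nbhs t)] --> chart i (g t).
Proof.
move=> /subspace_continuousP cg tcd it.
by apply: continuous_cvg; [exact: chart_cvg | exact: cg].
Qed.

(** Both sides are limits of the same quotient of [chart j \o g] relative to the segment, one by
    hypothesis and one by the chain rule for the transition map. The ends of the piece are
    included. *)
Lemma velocity_tcoord g c d w i j t : c < d -> {within `[c, d], continuous g} ->
  chart_velocity g c d w -> t \in `[c, d] -> dom i (g t) -> dom j (g t) ->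
  w j t = tcoord i j (g t) (w i t).
Proof.
move=> cd cg wP tcd it jt.
have [_ _ qi] := wP _ _ tcd it; have [_ _ qj] := wP _ _ tcd jt.
have PF := within_segment_proper cd tcd.
apply: (cvg_unique _ qj); first exact: norm_hausdorff.
have cgi : chart i (g u) @[u --> within `[c, d] t^'] --> chart i (g t).
  by apply: cvg_trans (chart_curve_cvg cg tcd it); exact/cvg_app/within_dnbhsW.
have FF : Filter (within `[c, d] t^') by exact: within_filter.
have := @diff_quotient_cvg _ _ _ _ FF _ _ _ _ _
  (transition_differentiable it jt) cgi qi.
apply: cvg_trans; apply: near_eq_cvg; near=> u.
rewrite /= (@chartK _ _ _ _ i (g t))// chartK//.
by near: u; apply/within_dnbhsW/curve_near => //; exact: nbhs_dom.
Unshelve. all: by end_near. Qed.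

Lemma velocityE g c d w t : chart_velocity g c d w -> t \in `]c, d[ ->
  velocity X g t = w (chart_at X (g t)) t.
Proof.
move=> wP tcd; have tcd' := subset_itv_oo_cc tcd.
have [_ _ q] := wP _ _ tcd' (dom_chart_at X (g t)).
by rewrite /velocity derive1E; have [_ ->] := is_derive_within tcd q.
Qed.

End Pieces.

(** * Framed norms and speeds *)

Section MatrixNorm.
Context (R : realType).

Lemma le_mx_norm m n (A : 'M[R]_(m, n)) i j : `|A i j| <= `|A|.
Proof.
by rewrite [leRHS]mx_normrE; apply: (le_bigmax _ (fun ij => `|A ij.1 ij.2|) (i, j)).
Qed.

Lemma mx_norm_leP m n (A : 'M[R]_(m, n)) (e : R) : 0 <= e ->
  `|A| <= e <-> forall i j, `|A i j| <= e.
Proof.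
move=> e0; split=> [Ae i j|Ae]; first exact: le_trans (le_mx_norm _ _ _) Ae.
by rewrite [leLHS]mx_normrE; apply: bigmax_le => // -[i j] _.
Qed.

Lemma mx_normM m n p (A : 'M[R]_(m, n)) (B : 'M[R]_(n, p)) :
  `|A *m B| <= n%:R * (`|A| * `|B|).
Proof.
apply/mx_norm_leP => [|i j]; first by rewrite !mulr_ge0.
rewrite mxE (le_trans (ler_norm_sum _ _ _))//.
have -> : n%:R * (`|A| * `|B|) = \sum_(l < n) `|A| * `|B|.
  by rewrite sumr_const card_ord mulr_natl.
by apply: ler_sum => l _; rewrite normrM ler_pM// le_mx_norm.
Qed.

Lemma mulmxl_cvg (T : Type) (F : set_system T) {FF : Filter F} m n p
    (f : T -> 'M[R]_(m, n)) (a : 'M[R]_(m, n)) (B : 'M[R]_(n, p)) :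
  f @ F --> a -> f x *m B @[x --> F] --> a *m B.
Proof.
move=> fa; apply/cvgrPdist_le => e e0.
have K0 : 0 < n%:R * `|B| + 1 by rewrite ltr_wpDl// mulr_ge0.
have /cvgrPdist_le/(_ (e / (n%:R * `|B| + 1))) := fa.
rewrite divr_gt0// => /(_ isT); apply: filterS => x xe.
rewrite -mulmxBl (le_trans (mx_normM _ _))// mulrCA.
rewrite (le_trans (ler_wpM2r _ xe)) ?mulr_ge0//.
rewrite mulrAC ler_pdivrMr// ler_wpM2l ?ltW//.
by rewrite ltrDl.
Qed.

(** Positivity supplies the index: a row may have no entry at all, and its norm is then 0. *)
Lemma mx_norm_coord m (A : 'rV[R]_m) : 0 < `|A| -> exists j, `|A| = `|A 0 j|.
Proof.
move=> A0; have := @mx_norm_neq0 _ _ _ A; rewrite -[mx_norm A]/`|A|.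
by rewrite gt_eqF// => /(_ isT)[[i j] /= ->]; exists j; rewrite (ord1 i).
Qed.

End MatrixNorm.

(** Turns a relative error into an absolute one: since [k <= 1 / 2], half of q is at most N, so
    [q <= 2 * (s + 1)], and then [k * q] is at most half of e. *)
Lemma relative_error_dist (R : realFieldType) (s N q k h e : R) :
  0 <= k -> k <= 1 / 2 -> k * (4 * (s + 1)) <= e -> h <= 1 -> h <= e / 4 ->
  0 <= q -> `|s - N| <= h -> `|N - q| <= k * q -> `|s - q| <= e.
Proof.
move=> k0 k1 k2 h1 h2 q0; rewrite !ler_norml => /andP[H1 H2] /andP[H3 H4].
have kq : k * q <= 1 / 2 * q by rewrite ler_wpM2r.
have q2 : q <= 2 * (s + 1) by lra.
have : k * q <= k * (2 * (s + 1)) by rewrite ler_wpM2l.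
by move=> ?; apply/andP; split; lra.
Qed.

Section Framed.
Context (R : realType) (n : nat) (M : topologicalType).
Context (X : smoothManifold R n M).

(* In the chart i the norm [F y] is close to the sup norm of the coordinates in
   a fixed basis of R^n, the rows of B, as y tends to x. *)
Definition locally_framed (F : M -> 'rV[R]_n -> R) : Prop :=
  forall (i : chart_index X) x, dom i x ->
  exists m (A : 'M[R]_(n, m)) (B : 'M[R]_(m, n)),
  [/\ A *m B = 1%:M,
      forall v, F x (tcoord i (chart_at X x) x v) = `|v *m A| &
      forall e, 0 < e -> \forall y \near x, forall v,
        `| `|v *m A| - F y (tcoord i (chart_at X y) y v) |
          <= e * F y (tcoord i (chart_at X y) y v)].

Context (F : M -> 'rV[R]_n -> R).
Context (framedF : locally_framed F).

Lemma framed_ge0 x v : 0 <= F x v.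
Proof.
have ix := dom_chart_at X x; have [m [A [B [_ FA _]]]] := framedF ix.
by rewrite -(tcoordK v ix ix) FA.
Qed.

Lemma framedN x v : F x (- v) = F x v.
Proof.
have ix := dom_chart_at X x; have [m [A [B [_ FA _]]]] := framedF ix.
by rewrite -{1}(tcoordK v ix ix) -tcoordN FA mulNmx normrN -FA tcoordK.
Qed.

(** The right inverse B of A makes multiplication of row vectors by A injective. *)
Lemma framed_gt0 x v : v != 0 -> 0 < F x v.
Proof.
have ix := dom_chart_at X x; have [m [A [B [AB FA _]]]] := framedF ix => v0.
set u := tcoord (chart_at X x) (chart_at X x) x v.
have vE : tcoord (chart_at X x) (chart_at X x) x u = v by exact: tcoordK.
rewrite -vE FA normr_gt0; apply/eqP => uA; move/eqP: v0; apply.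
rewrite -vE -[u]mulmx1 -AB mulmxA uA mul0mx.
by rewrite -(subrr 0) tcoordB !subrr.
Qed.

Definition speed (g : R -> M) t := F (g t) (velocity X g t).

Section Piece.
Context (g : R -> M) (c d : R) (w : chart_index X -> R -> 'rV[R]_n).
Context (cd : c < d) (cg : {within `[c, d], continuous g}).
Context (wP : chart_velocity g c d w).

(** Agrees with [speed] inside the piece, but is also meaningful at its ends, where [velocity] may
    be junk; this is the version that is continuous on the closed segment. *)
Definition piece_speed t := F (g t) (w (chart_at X (g t)) t).

Lemma piece_speed_gt0 t : t \in `[c, d] -> 0 < piece_speed t.
Proof.
move=> tcd; apply: framed_gt0.
by have [] := wP tcd (dom_chart_at X (g t)).
Qed.

Lemma piece_speedE i t : t \in `[c, d] -> dom i (g t) ->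
  piece_speed t = F (g t) (tcoord i (chart_at X (g t)) (g t) (w i t)).
Proof.
by move=> tcd it; rewrite -(velocity_tcoord cd cg wP tcd it)//; exact: dom_chart_at.
Qed.

(** The chart [chart_at X (g u)] may jump with u, so everything is read in the preferred chart at
    [g t]. There [|w i u *m A|] converges, and it differs from the speed by a small relative
    error. *)
Lemma piece_speed_continuous : {within `[c, d], continuous piece_speed}.
Proof.
apply/subspace_continuousP => t tcd; apply/cvgrPdist_le => e e0.
have it := dom_chart_at X (g t); have [m [A [B [_ FA nearA]]]] := framedF it.
set i := chart_at X (g t) in it FA nearA.
have FF : Filter (within `[c, d] (nbhs t)) by exact: within_filter.
have [_ wt _] := wP tcd it.
have cvgs : `|w i u *m A| @[u --> within `[c, d] (nbhs t)] --> piece_speed t.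
  by rewrite (piece_speedE tcd it) FA; apply: cvg_norm; exact: mulmxl_cvg.
set s := piece_speed t in cvgs *.
have s0 : 0 < s by exact: piece_speed_gt0.
pose k := Num.min (1 / 2) (e / (4 * (s + 1))).
have k0 : 0 < k by rewrite lt_min !divr_gt0// mulr_gt0// ltr_wpDl// ltW.
have k1 : k <= 1 / 2 by rewrite ge_min lexx.
have k2 : k * (4 * (s + 1)) <= e.
  by rewrite -ler_pdivlMr ?ge_min ?lexx ?orbT// mulr_gt0// ltr_wpDl// ltW.
pose h := Num.min 1 (e / 4).
have h0 : 0 < h by rewrite lt_min ltr01 divr_gt0.
have h1 : h <= 1 by rewrite ge_min lexx.
have h2 : h <= e / 4 by rewrite ge_min lexx orbT.
move/cvgrPdist_le : cvgs => /(_ _ h0) nears.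
have near_dom := curve_near cg tcd (nbhs_dom it).
have nearA' := curve_near cg tcd (nearA _ k0).
have near_cd : \forall u \near within `[c, d] (nbhs t), `[c, d]%classic u.
  exact: withinT.
near=> u.
have ucd : u \in `[c, d] by near: u.
have iu : dom i (g u) by near: u.
have Hs : `|s - `|w i u *m A| | <= h by near: u.
have Hk : `| `|w i u *m A| - F (g u) (tcoord i (chart_at X (g u)) (g u) (w i u)) |
    <= k * F (g u) (tcoord i (chart_at X (g u)) (g u) (w i u)).
  by move: (w i u); near: u.
rewrite -piece_speedE// in Hk.
have su0 : 0 < piece_speed u by exact: piece_speed_gt0.
exact: (relative_error_dist (ltW k0) k1 k2 h1 h2 (ltW su0) Hs Hk).
Unshelve. all: by end_near. Qed.

Lemma speedE t : t \in `]c, d[ -> speed g t = piece_speed t.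
Proof. by move=> tcd; rewrite /speed (velocityE wP tcd). Qed.

Lemma measurable_speed_piece : measurable_fun `[c, d] (speed g).
Proof.
apply: (@measurable_fun_itv_cc _ _ _ false true).
apply: (eq_measurable_fun piece_speed).
  by move=> t; rewrite inE => tcd; rewrite speedE.
apply: (@measurable_funS _ _ _ _ `[c, d]) => //; first exact: subset_itv_oo_cc.
by apply: subspace_continuous_measurable_fun => //; exact: piece_speed_continuous.
Qed.

Lemma integral_speed_piece :
  curve_integral X F c d g =
  (\int[lebesgue_measure]_(t in `[c, d]) (piece_speed t)%:E)%E.
Proof.
rewrite /curve_integral.
apply: (@eq_integral_itv_bounded _ _ _ _ _ true false).
- apply: (@measurable_funS _ _ _ _ `[c, d]) => //; first exact: subset_itv_oo_cc.
  exact: measurable_speed_piece.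
- apply: (@measurable_funS _ _ _ _ `[c, d]) => //; first exact: subset_itv_oo_cc.
  by apply: subspace_continuous_measurable_fun => //; exact: piece_speed_continuous.
- by move=> t tcd; rewrite -speedE// -inE.
Qed.

Lemma integral_speed_piece_bounds (m K : R) :
  (forall t, t \in `[c, d] -> m <= piece_speed t <= K) ->
  ((m * (d - c))%:E <= curve_integral X F c d g <= (K * (d - c))%:E)%E.
Proof.
move=> mK; rewrite integral_speed_piece.
have cst_int r : (\int[lebesgue_measure]_(t in `[c, d]) (cst r t)%:E
    = (r * (d - c))%:E)%E.
  rewrite (_ : (fun t => _) = cst r%:E)// integral_cst//= lebesgue_measure_itv/=.
  by rewrite lte_fin cd -EFinB -EFinM.
have int_s : lebesgue_measure.-integrable `[c, d] (EFin \o piece_speed).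
  apply: continuous_compact_integrable; first exact: segment_compact.
  exact: piece_speed_continuous.
have int_c r : lebesgue_measure.-integrable `[c, d] (EFin \o cst r : R -> \bar R).
  apply: continuous_compact_integrable; first exact: segment_compact.
  by apply: continuous_subspaceT => x; exact: cvg_cst.
rewrite -!cst_int; apply/andP; split; apply: le_integral => //.
- exact: int_c.
- by move=> t; rewrite inE => /mK /andP[]; rewrite /= lee_fin.
- exact: int_c.
- by move=> t; rewrite inE => /mK /andP[]; rewrite /= lee_fin.
Qed.

(** On the compact segment the speed is continuous and, the piece being regular, positive, so it
    lies between two positive constants. *)
Lemma integral_speed_piece_fin : (0 < curve_integral X F c d g < +oo)%E.
Proof.
have [tm tmcd mP] := EVT_min (ltW cd) piece_speed_continuous.
have [tM _ MP] := EVT_max (ltW cd) piece_speed_continuous.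
have /andP[H1 H2] : ((piece_speed tm * (d - c))%:E <= curve_integral X F c d g
    <= (piece_speed tM * (d - c))%:E)%E.
  by apply: integral_speed_piece_bounds => t tcd; rewrite mP// MP.
apply/andP; split; last by apply: le_lt_trans H2 _; rewrite ltry.
by apply: lt_le_trans H1; rewrite lte_fin mulr_gt0 ?subr_gt0// piece_speed_gt0.
Qed.

End Piece.
End Framed.

(** * Piecewise regular curves *)

Lemma within_subsetW (T : Type) (F : set_system T) {FF : Filter F} (A B : set T) :
  A `<=` B -> within A F `=>` within B F.
Proof.
move=> AB U; rewrite /within/= => FBU.
by apply: filterS FBU => x BU /AB; exact: BU.
Qed.

Lemma subset_segment (R : realType) (a b c d : R) : a <= c -> d <= b ->
  `[c, d] `<=` `[a, b].
Proof.
move=> ac db t /=; rewrite !in_itv/= => /andP[ct td].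
by rewrite (le_trans ac ct) (le_trans td db).
Qed.

Section Chains.
Context (R : realType) (n : nat) (M : topologicalType).
Context (X : smoothManifold R n M).
Implicit Types (g : R -> M) (a b c d t : R).

Lemma near_within_opp c d t (U : set R) :
  (\forall u \near within `[c, d] (nbhs (- t)), U u) ->
  \forall u \near within `[- d, - c] (nbhs t), U (- u).
Proof.
rewrite !near_withinE => nearU.
have : \forall u \near t, - u \in `[c, d] -> U (- u).
  exact: (@oppr_continuous R R^o t _ nearU).
by apply: filterS => u; rewrite oppr_itvcc.
Qed.

Lemma near_within_dnbhs_opp c d t (U : set R) :
  (\forall u \near within `[c, d] (- t)^', U u) ->
  \forall u \near within `[- d, - c] t^', U (- u).
Proof.
rewrite !near_withinE => nearU.
have nearU' : \forall u \near - t, u != - t -> u \in `[c, d] -> U u by [].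
have : \forall u \near t, - u != - t -> - u \in `[c, d] -> U (- u).
  exact: (@oppr_continuous R R^o t _ nearU').
by apply: filterS => u; rewrite eqr_opp oppr_itvcc.
Qed.

Lemma curve_opp_continuous g c d : {within `[c, d], continuous g} ->
  {within `[- d, - c], continuous (g \o -%R)}.
Proof.
move=> cg; apply/subspace_continuousP => t tcd U.
have tcd' : - t \in `[c, d] by rewrite oppr_itvcc.
by move=> /(curve_near cg tcd'); exact: near_within_opp.
Qed.

Lemma chart_velocity_opp g c d w : chart_velocity g c d w ->
  chart_velocity (g \o -%R) (- d) (- c) (fun i : chart_index X => - (w i \o -%R)).
Proof.
move=> wP i t tcd it; rewrite !fctE /=.
have tcd' : - t \in `[c, d] by rewrite oppr_itvcc.
have [w0 wt q] := wP i (- t) tcd' it.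
split; first by rewrite oppr_eq0.
- apply: cvgN => U /wt; exact: near_within_opp.
- rewrite (_ : (fun u => _) = (fun u => - ((- u - - t)^-1 *:
      (chart i (g (- u)) - chart i (g (- t)))))); last first.
    by apply/funext => u; rewrite -scaleNr -invrN opprB opprK addrC.
  apply: cvgN => U /q; exact: near_within_dnbhs_opp.
Qed.

Lemma chart_velocity_sub g a b c d w : a <= c -> d <= b ->
  chart_velocity g a b w -> chart_velocity (X := X) g c d w.
Proof.
move=> ac db wP i t tcd it.
have sub : `[c, d] `<=` `[a, b] by exact: subset_segment.
have [w0 wt q] := wP i t (sub _ tcd) it; split => //.
- by apply: cvg_trans wt; apply: cvg_app; exact: within_subsetW.
- by apply: cvg_trans q; apply: cvg_app; exact: within_subsetW.
Qed.

(** Piecewise regular curves as a closure under concatenation: additive facts follow by induction,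
    without indices into a partition. Velocities need not match at junctions, and continuity on the
    whole segment is a separate hypothesis where it is used. *)
Inductive regular_chain g : R -> R -> Prop :=
| regular_chain_piece c d w : c < d -> {within `[c, d], continuous g} ->
    chart_velocity (X := X) g c d w -> regular_chain g c d
| regular_chain_cat a b c : regular_chain g a b -> regular_chain g b c ->
    regular_chain g a c.

Lemma regular_chain_lt g a b : regular_chain g a b -> a < b.
Proof. by elim=> // c d e _ cd _; exact: lt_trans. Qed.

Lemma regular_chain_sub g a b c d : regular_chain g a b ->
  a <= c -> c < d -> d <= b -> regular_chain g c d.
Proof.
move=> ch; elim: ch c d => [a' b' w ab cg wP c d ac cd db|].
  apply: (regular_chain_piece (w := w)) => //.
    by apply: continuous_subspaceW cg; exact: subset_segment.
  exact: chart_velocity_sub wP.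
move=> a' e b' _ IH1 _ IH2 c d ac cd db.
have [de|ed] := leP d e; first exact: IH1.
have [ec|ce] := leP e c; first exact: IH2.
by apply: (@regular_chain_cat _ _ e); [exact: IH1|exact: IH2].
Qed.

Lemma regular_chain_opp g a b : regular_chain g a b ->
  regular_chain (g \o -%R) (- b) (- a).
Proof.
elim=> [c d w cd cg /chart_velocity_opp wP|c d e _ H1 _ H2].
  apply: regular_chain_piece wP; first by rewrite ltrN2.
  exact: curve_opp_continuous.
exact: regular_chain_cat H2 H1.
Qed.

Lemma pwC1_curve_chain g a b : pwC1_curve X a b g -> regular_chain g a b.
Proof.
move=> [ab cg [s [sp /eqP sb] sreg]].
have : path (fun c d => `[< regular_C1 X g c d >]) a s.
  by apply/(pathP b) => j js; apply/asboolP; exact: sreg.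
elim: s a {sreg} ab cg sp sb => [|c s IH] a ab cg /=.
  by move=> _ ab'; rewrite ab' ltxx in ab.
move=> /andP[ac sc] sb /andP[/asboolP regac regs].
have [w wP] := regular_C1_velocity regac.
have cb : c <= b by apply: (@itv_partition_le _ _ c b s); split => //; exact/eqP.
have ch : regular_chain g a c.
  apply: regular_chain_piece wP => //.
  by apply: continuous_subspaceW cg; exact: subset_segment.
move: cb; rewrite le_eqVlt => /predU1P[<-//|cb].
apply: (regular_chain_cat ch); apply: IH => //.
by apply: continuous_subspaceW cg; apply: subset_segment => //; exact: ltW.
Qed.

Lemma regular_chain_pwC1 g a b : {within `[a, b], continuous g} ->
  regular_chain g a b -> pwC1_curve X a b g.
Proof.
move=> cg ch; split => //; first exact: regular_chain_lt ch.
suff [s [sp sb]] : exists s, [/\ path <%R a s, last a s = b &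
    path (fun c d => `[< regular_C1 X g c d >]) a s].
  move=> /(pathP b) sreg; exists s; first by split => //; apply/eqP.
  by move=> j /sreg/asboolP.
elim: ch {cg} => [c d w cd _ wP|a' c b' _ [s [sp sl sr]] _ [t [tp tl tr]]].
  exists [:: d]; split; rewrite /= ?andbT//.
  by apply/asboolP => i; exists (w i) => t; exact: wP.
by exists (s ++ t); rewrite !cat_path last_cat sl sp sr.
Qed.

Context (F : M -> 'rV[R]_n -> R).
Context (framedF : locally_framed X F).
Local Notation I := (curve_integral X F).

Lemma curve_integral_ge0 g a b : (0 <= I a b g)%E.
Proof. by apply: integral_ge0 => t _; rewrite lee_fin (framed_ge0 framedF). Qed.

Lemma measurable_speed_chain g a b : regular_chain g a b ->
  measurable_fun `[a, b] (speed X F g).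
Proof.
elim=> [c d w cd cg wP|c d e ch1 m1 ch2 m2].
  exact: (measurable_speed_piece framedF cd cg wP).
rewrite (@itv_bndbnd_setU _ _ (BLeft c) (BLeft d) (BRight e)).
- apply/measurable_funU => //; split => //.
  by apply: measurable_funS m1 => //; exact: subset_itv_co_cc.
- by rewrite bnd_simp ltW// (regular_chain_lt ch1).
- by rewrite bnd_simp ltW// (regular_chain_lt ch2).
Qed.

Lemma curve_integral_split g a b c : regular_chain g a b -> a <= c -> c <= b ->
  I a b g = (I a c g + I c b g)%E.
Proof.
move=> ch ac cb; have ms := measurable_speed_chain ch.
rewrite /curve_integral (@itv_bndbnd_setU _ _ (BLeft a) (BRight c) (BRight b)).
- rewrite ge0_integral_setU//=.
  + congr (_ + _)%E; apply: integral_itv_obnd_cbnd.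
    apply/measurable_EFinP; apply: measurable_funS ms => //.
    by move=> t /=; rewrite !in_itv/= => /andP[ct ->]; rewrite (le_trans ac)// ltW.
  + by apply/measurable_EFinP; rewrite -itv_bndbnd_setU// bnd_simp.
  + by move=> t _; rewrite lee_fin (framed_ge0 framedF).
  + apply/disj_setPLR => t /=; rewrite !in_itv/= => /andP[_ tc].
    by apply/negP; rewrite negb_and -leNgt tc.
- by rewrite bnd_simp.
- by rewrite bnd_simp.
Qed.

Lemma curve_integral_fin g a b : regular_chain g a b -> (0 < I a b g < +oo)%E.
Proof.
elim=> [c d w cd cg wP|c d e ch1 /andP[p1 f1] ch2 /andP[p2 f2]].
  exact: (integral_speed_piece_fin framedF cd cg wP).
have ch := regular_chain_cat ch1 ch2.
rewrite (curve_integral_split ch (ltW (regular_chain_lt ch1)) (ltW (regular_chain_lt ch2))).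
by rewrite lte_add_pinfty// adde_gt0.
Qed.

(** Reversal negates the velocity, which F does not see; on a piece what remains is the substitution
    of -t for t. *)
Lemma curve_integral_opp g a b : regular_chain g a b ->
  I (- b) (- a) (g \o -%R) = I a b g.
Proof.
elim=> [c d w cd cg wP|c d e ch1 m1 ch2 m2]; last first.
  have ch := regular_chain_cat ch1 ch2.
  have cd := ltW (regular_chain_lt ch1); have de := ltW (regular_chain_lt ch2).
  transitivity (I (- e) (- d) (g \o -%R) + I (- d) (- c) (g \o -%R))%E.
    have ed : - e <= - d by rewrite lerN2.
    have dc : - d <= - c by rewrite lerN2.
    exact (curve_integral_split (regular_chain_opp ch) ed dc).
  transitivity (I d e g + I c d g)%E; first by exact (f_equal2 (fun x y => x + y)%E m2 m1).
  by rewrite addeC (curve_integral_split ch cd de).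
have cgN := curve_opp_continuous cg.
rewrite (integral_speed_piece framedF cd cg wP).
have dc : - d < - c by rewrite ltrN2.
rewrite (integral_speed_piece framedF dc cgN (chart_velocity_opp wP)).
have := @integration_by_substitution_oppr R (piece_speed F g w) (- d) (- c).
rewrite !opprK => ->; [|exact: ltW|exact: piece_speed_continuous wP].
by apply: eq_integral => t _; rewrite /piece_speed /= !fctE (framedN framedF).
Qed.

End Chains.

(** * Displacement in a chart *)

(** Completeness in Cousin's form: the supremum of the points up to which P holds inherits P by the
    left clause, and below b the right clause would push it further. It serves both to confine a
    competitor to a chart and to build a partition. *)
Lemma segment_induction (R : realType) (a b : R) (P : R -> Prop) :
  P a ->
  (forall t, a <= t -> t < b -> P t ->
    exists2 r, 0 < r & forall u, t < u -> u <= t + r -> u <= b -> P u) ->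
  (forall t, a < t -> t <= b -> (forall u, a <= u -> u < t -> P u) -> P t) ->
  forall t, a <= t -> t <= b -> P t.
Proof.
move=> Pa right left t0 at0 t0b.
pose S := [set t | [/\ a <= t, t <= b & forall u, a <= u -> u <= t -> P u]].
have Sa : S a.
  split => //; first exact: le_trans t0b.
  by move=> u au ua; rewrite (_ : u = a)//; apply/eqP; rewrite eq_le ua.
have hS : has_sup S by split; [exists a | exists b => t []].
set s := sup S; have as_ : a <= s by exact: sup_upper_bound.
have sb : s <= b by apply: ge_sup; [exists a | move=> t []].
have Plt u : a <= u -> u < s -> P u.
  move=> au us; have us0 : 0 < s - u by rewrite subr_gt0.
  have [e [_ _ Pe]] := sup_adherent us0 hS.
  by rewrite -/s subKr => ue; apply: Pe => //; exact: ltW.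
have Ps : P s.
  move: as_; rewrite le_eqVlt => /predU1P[<-//|as_].
  exact: left.
have Ple u : a <= u -> u <= s -> P u.
  by move=> au; rewrite le_eqVlt => /predU1P[->//|]; exact: Plt.
suff sbE : s = b by apply: Ple; rewrite ?sbE.
apply/eqP; move: sb; rewrite le_eqVlt => /predU1P[->//|sb].
have [r r0 Pr] := right _ as_ sb Ps.
pose s' := Num.min (s + r) b.
have ss' : s < s' by rewrite lt_min sb ltrDl r0.
suff : S s' by move/(sup_upper_bound hS); rewrite -/s leNgt ss'.
split; [by rewrite (le_trans as_)// ltW | by rewrite ge_min lexx orbT |].
move=> u au us'; have [us|su] := leP u s; first exact: Ple.
apply: Pr => //; first by rewrite (le_trans us')// ge_min lexx.
by rewrite (le_trans us')// ge_min lexx orbT.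
Qed.

Section LowerBounds.
Context (R : realType) (n : nat) (M : topologicalType).
Context (X : smoothManifold R n M).
Context (F : M -> 'rV[R]_n -> R).
Context (framedF : locally_framed X F).
Local Notation I := (curve_integral X F).
Implicit Types (g : R -> M) (i : chart_index X) (x y : M).

Section ChartCoordinate.
Context (g : R -> M) (c d : R) (w : chart_index X -> R -> 'rV[R]_n).
Context (cd : c < d) (cg : {within `[c, d], continuous g}).
Context (wP : chart_velocity g c d w).
Context (i : chart_index X) (m : nat) (A : 'M[R]_(n, m)) (j : 'I_m).
Context (gi : forall t, t \in `[c, d] -> dom i (g t)).

Definition chart_coordinate t := (chart i (g t) *m A) 0 j.
Definition chart_coordinate' t := (w i t *m A) 0 j.

Lemma chart_coordinate_continuous : {within `[c, d], continuous chart_coordinate}.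
Proof.
apply/subspace_continuousP => t tcd.
apply: (@continuous_cvg _ _ _ _ _ _ (fun B : 'M[R]_(1, m) => B 0 j)).
  exact: coord_continuous.
by apply: mulmxl_cvg; exact: (chart_curve_cvg cg tcd (gi tcd)).
Qed.

Lemma chart_coordinate'_continuous : {within `[c, d], continuous chart_coordinate'}.
Proof.
apply/subspace_continuousP => t tcd.
apply: (@continuous_cvg _ _ _ _ _ _ (fun B : 'M[R]_(1, m) => B 0 j)).
  exact: coord_continuous.
by apply: mulmxl_cvg; have [] := wP tcd (gi tcd).
Qed.

Lemma is_derive_chart_coordinate t : t \in `]c, d[ ->
  is_derive t 1 chart_coordinate (chart_coordinate' t).
Proof.
move=> tcd; apply: (is_derive_within tcd).
have tcd' := subset_itv_oo_cc tcd.
have [_ _ q] := wP tcd' (gi tcd').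
rewrite (_ : (fun u => _) =
  (fun u => (((u - t)^-1 *: (chart i (g u) - chart i (g t))) *m A) 0 j)); last first.
  apply/funext => u; rewrite -scalemxAl mulmxBl mxE [X in _ = _ * X]mxE.
  by rewrite [X in _ = _ * (_ + X)]mxE.
apply: (@continuous_cvg _ _ _ _ _ _ (fun B : 'M[R]_(1, m) => B 0 j)).
  exact: coord_continuous.
exact: mulmxl_cvg.
Qed.

(** The fundamental theorem of calculus for one scalar coordinate, followed by integration of the
    pointwise bound. *)
Lemma chart_coordinate_le (k : R) :
  (forall t, t \in `[c, d] -> `|chart_coordinate' t| <= k * piece_speed F g w t) ->
  (`|chart_coordinate d - chart_coordinate c|%:E <= k%:E * I c d g)%E.
Proof.
move=> hk.
have cc' := chart_coordinate'_continuous.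
have FTC : (\int[lebesgue_measure]_(t in `[c, d]) (chart_coordinate' t)%:E =
    (chart_coordinate d)%:E - (chart_coordinate c)%:E)%E.
  apply: continuous_FTC2 => //.
  - have [_ rc lc] := (continuous_within_itvP _ cd).1 chart_coordinate_continuous.
    by split => // t tcd; exact: (@ex_derive _ _ _ _ _ _ _ (is_derive_chart_coordinate tcd)).
  - move=> t tcd; rewrite derive1E.
    exact: (@derive_val _ _ _ _ _ _ _ (is_derive_chart_coordinate tcd)).
rewrite -abse_EFin EFinB -FTC.
have ps_int : lebesgue_measure.-integrable `[c, d] (EFin \o piece_speed F g w).
  apply: continuous_compact_integrable; first exact: segment_compact.
  exact: (piece_speed_continuous framedF cd cg wP).
have mcc : measurable_fun `[c, d] chart_coordinate'.
  exact: subspace_continuous_measurable_fun.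
have mps : measurable_fun `[c, d] (piece_speed F g w).
  apply: subspace_continuous_measurable_fun => //.
  exact: (piece_speed_continuous framedF cd cg wP).
rewrite (integral_speed_piece framedF cd cg wP).
apply: (le_trans (le_abse_integral _ _ _)) => //; first exact/measurable_EFinP.
rewrite -integralZl//; apply: ge0_le_integral => //.
- by apply: measurableT_comp => //; exact/measurable_EFinP.
- by apply: measurable_funeM; exact/measurable_EFinP.
Qed.

End ChartCoordinate.

Lemma curve_integral_EFin g a b : regular_chain X g a b ->
  (I a b g = (fine (I a b g))%:E)%E.
Proof.
move=> /(curve_integral_fin framedF)/andP[I0 Ioo].
by rewrite fineK// ge0_fin_numE// ltW.
Qed.

(** The norm on rows is the sup norm, so it suffices to bound each coordinate, and no vector-valued
    integral is formed. Junctions of the chain cost only a triangle inequality. *)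
Lemma chart_displacement_le g i m (A : 'M[R]_(n, m)) k a b : 0 <= k ->
  regular_chain X g a b ->
  (forall t, t \in `[a, b] -> dom i (g t)) ->
  (forall t, t \in `[a, b] -> forall v,
    `|v *m A| <= k * F (g t) (tcoord i (chart_at X (g t)) (g t) v)) ->
  (`|(chart i (g b) - chart i (g a)) *m A|%:E <= k%:E * I a b g)%E.
Proof.
move=> k0; elim=> {a b} [c d w cd cg wP gi hk|a c b ch1 IH1 ch2 IH2 gi hk].
  have ch := regular_chain_piece cd cg wP.
  rewrite (curve_integral_EFin ch) -EFinM lee_fin; apply/mx_norm_leP.
    by rewrite mulr_ge0// fine_ge0// (curve_integral_ge0 framedF).
  move=> l j; rewrite (ord1 l) mulmxBl -lee_fin EFinM -(curve_integral_EFin ch).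
  rewrite mxE [X in _ + X]mxE; apply: (chart_coordinate_le cd cg wP gi) => t tcd.
  rewrite (piece_speedE F cd cg wP tcd (gi _ tcd)).
  exact: le_trans (le_mx_norm _ _ _) (hk t tcd _).
have ac := ltW (regular_chain_lt ch1); have cb := ltW (regular_chain_lt ch2).
rewrite (curve_integral_split framedF (regular_chain_cat ch1 ch2) ac cb).
rewrite ge0_muleDr ?(curve_integral_ge0 framedF)//.
rewrite -(subrKA (chart i (g c))) mulmxDl.
apply: (@le_trans _ _ (`|(chart i (g b) - chart i (g c)) *m A| +
    `|(chart i (g c) - chart i (g a)) *m A|)%:E).
  by rewrite lee_fin ler_normD.
rewrite EFinD addeC; apply: leeD.
- apply: IH1 => t tac; have tab := subset_segment (lexx a) cb tac.
  exact: gi.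
  exact: hk.
- apply: IH2 => t tcb; have tab := subset_segment ac (lexx b) tcb.
  exact: gi.
  exact: hk.
Qed.

End LowerBounds.

(** * Curves that may leave the chart *)

Section Competitors.
Context (R : realType) (n : nat) (M : topologicalType).
Context (X : smoothManifold R n M).
Context (F : M -> 'rV[R]_n -> R).
Context (framedF : locally_framed X F).
Local Notation I := (curve_integral X F).
Implicit Types (g : R -> M) (i : chart_index X) (x y : M).

Lemma nbhs_chart_ball i x y r : dom i y -> `|chart i x - chart i y| < r ->
  nbhs y [set z | dom i z /\ `|chart i x - chart i z| < r].
Proof.
move=> iy yr; apply: filterI; first exact: nbhs_dom.
have : `|chart i x - chart i z| @[z --> y] --> `|chart i x - chart i y|.
  by apply: cvg_norm; apply: cvgB; [exact: cvg_cst | exact: chart_cvg].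
by move=> /cvgr_lt; apply.
Qed.

(** The set is the image of a compact ball under [chart_inv i], hence compact, hence closed because
    M is Hausdorff. Consequently a curve whose coordinates have stayed in the ball cannot be outside
    [dom i] at a limit time. *)
Lemma closed_chart_ball i x r :
  (forall p, `|chart i x - p| <= r -> (chart i @` dom i) p) ->
  closed [set y | dom i y /\ `|chart i x - chart i y| <= r].
Proof.
move=> subr.
have -> : [set y | dom i y /\ `|chart i x - chart i y| <= r] =
    chart_inv i @` closed_ball_ Num.norm (chart i x) r.
  apply/seteqP; split => [y [iy yr]|y [p /= pr <-]].
    by exists (chart i y) => //; rewrite chartK.
  by have [z iz zp] := subr _ pr; rewrite -zp chartK//= zp.
apply: compact_closed; first exact: (manifold_hausdorff X).
apply: continuous_compact.
  apply: continuous_subspaceW (@chart_inv_continuous _ _ _ X i) => p pr.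
  exact: subr.
apply: bounded_closed_compact; last exact: closed_closed_ball_.
exists (`|chart i x| + r); split; first exact: num_real.
move=> N ltN p /= pr; rewrite (le_trans _ (ltW ltN))// -(subKr (chart i x) p).
by rewrite (le_trans (ler_normB _ _))// lerD2l.
Qed.

(* A competitor either stays in the chart, where its displacement is controlled
   by [chart_displacement_le], or has to cross a fixed annulus around x. *)
Lemma near_displacement_le i x m (A : 'M[R]_(n, m)) (B : 'M[R]_(m, n)) k :
  0 <= k -> dom i x -> A *m B = 1%:M ->
  (\forall y \near x, forall v,
    `|v *m A| <= k * F y (tcoord i (chart_at X y) y v)) ->
  exists2 V, nbhs x V & forall g a b, regular_chain X g a b ->
    {within `[a, b], continuous g} -> V (g a) -> V (g b) ->
    (`|(chart i (g b) - chart i (g a)) *m A|%:E <= k%:E * I a b g)%E.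
Proof.
move=> k0 ix AB nearF.
have [r r0 rP] : exists2 r, 0 < r & forall p, `|chart i x - p| <= r ->
    (chart i @` dom i) p /\
    (forall v, `|v *m A| <= k * F (chart_inv i p)
      (tcoord i (chart_at X (chart_inv i p)) (chart_inv i p) v)).
  have : \forall p \near chart i x, (chart i @` dom i) p /\
    (forall v, `|v *m A| <= k * F (chart_inv i p)
      (tcoord i (chart_at X (chart_inv i p)) (chart_inv i p) v)).
    apply: filterI; first exact: nbhs_codom.
    exact: (chart_inv_cvg ix nearF).
  move=> /nbhs_ballP[e /= e0 eP]; exists (e / 2); first exact: divr_gt0.
  move=> p pe; apply: eP; rewrite -ball_normE /ball_/=.
  by rewrite (le_lt_trans pe)// ltr_pdivrMr// ltr_pMr// ltr1n.
have Pnear y : dom i y -> `|chart i x - chart i y| <= r -> forall v,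
    `|v *m A| <= k * F y (tcoord i (chart_at X y) y v).
  by move=> iy /rP[_]; rewrite chartK.
have clK : closed [set y | dom i y /\ `|chart i x - chart i y| <= r].
  by apply: closed_chart_ball => p /rP[].
(* C and D compare [|v|] with [|v *m A|] in the two directions; the added 1 keeps them positive. *)
pose C := m%:R * `|B| + 1; have C0 : 0 < C by rewrite ltr_wpDl// mulr_ge0.
have CP (v : 'rV[R]_n) : `|v| <= C * `|v *m A|.
  rewrite -{1}[v]mulmx1 -AB mulmxA (le_trans (mx_normM _ _))//.
  by rewrite [`|v *m A| * _]mulrC mulrA ler_wpM2r// lerDl.
pose D := n%:R * `|A| + 1; have D0 : 0 < D by rewrite ltr_wpDl// mulr_ge0.
have DP (v : 'rV[R]_n) : `|v *m A| <= D * `|v|.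
  rewrite (le_trans (mx_normM _ _))//.
  by rewrite [`|v| * _]mulrC mulrA ler_wpM2r// lerDl.
(* Endpoints within q of x differ by less than 2q, so their [A]-displacement is below 2qD; the
   second bound gives 2qCD <= r / 3, and with q <= r / 3 a total deviation below r remains. *)
pose q := Num.min (r / 3) (r / (6 * (C * D))).
have CD0 : 0 < 6 * (C * D) by rewrite !mulr_gt0.
have q0 : 0 < q by rewrite lt_min !divr_gt0.
have q1 : q <= r / 3 by rewrite ge_min lexx.
have q2 : q * (6 * (C * D)) <= r.
  by rewrite -ler_pdivlMr// ge_min lexx orbT.
exists [set y | dom i y /\ `|chart i x - chart i y| < q].
  by apply: nbhs_chart_ball => //; rewrite subrr normr0.
move=> g a b ch cg [ia xa] [ib xb].
have ab := ltW (regular_chain_lt ch).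
(* If the estimate failed, the integral L would be so small that the curve could not leave the ball
   of radius r, and there the estimate holds. *)
rewrite (curve_integral_EFin framedF ch) -EFinM lee_fin leNgt; apply/negP => ltL.
set L := fine _ in ltL.
have dist_ab : `|chart i (g b) - chart i (g a)| < q + q.
  rewrite -(subrKA (chart i x)) (le_lt_trans (ler_normD _ _))// ltrD//.
  by rewrite distrC.
have CkL : C * (k * L) < r / 3.
  have : k * L < D * (q + q).
    apply: (lt_le_trans ltL); apply: (le_trans (DP _)).
    by rewrite ler_wpM2l// ltW.
  rewrite -(ltr_pM2l C0) => /lt_le_trans; apply; lra.
have Pball t : a <= t -> t <= b -> dom i (g t) /\ `|chart i x - chart i (g t)| < r.
  (* Openness of the ball gives the right clause. For the left one, closedness gives the weak
     inequality at t, and the displacement bound on [a, t] makes it strict. *)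
  apply: (segment_induction (P := fun t => dom i (g t) /\ `|chart i x - chart i (g t)| < r)).
  - by split => //; apply: (lt_le_trans xa); lra.
  - move=> {}t at_ tb [it tr].
    have tab : t \in `[a, b] by rewrite in_itv/= at_ ltW.
    have /nbhs_ballP[e /= e0 eP] := curve_near cg tab (nbhs_chart_ball it tr).
    exists (e / 2); first exact: divr_gt0.
    move=> u tu ue ub; apply: eP; last by rewrite /= in_itv/= ub (le_trans at_)// ltW.
    by rewrite -ball_normE /ball_/= distrC gtr0_norm ?subr_gt0//; lra.
  - move=> {}t at_ tb Plt.
    have tab : t \in `[a, b] by rewrite in_itv/= tb ltW.
    have [it tr] : dom i (g t) /\ `|chart i x - chart i (g t)| <= r.
      apply: contrapT => nK.
      have nearU : nbhs (g t) (~` [set y | dom i y /\ `|chart i x - chart i y| <= r]).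
        by apply: open_nbhs_nbhs; split => //; exact: closed_openC.
      have /nbhs_ballP[e /= e0 eP] := curve_near cg tab nearU.
      pose u := Num.max a (t - e / 2).
      have au : a <= u by rewrite le_max lexx.
      have ut : u < t by rewrite gt_max at_ ltrBlDr ltrDl divr_gt0.
      have eu : t - e / 2 <= u by rewrite le_max lexx orbT.
      have [iu ur] := Plt u au ut.
      suff : ~ (dom i (g u) /\ `|chart i x - chart i (g u)| <= r).
        by apply; split => //; exact: ltW.
      apply: eP; last by rewrite /= in_itv/= au (le_trans (ltW ut)).
      by rewrite -ball_normE /ball_/= gtr0_norm ?subr_gt0//; lra.
    split => //.
    have tle u : u \in `[a, t] -> dom i (g u) /\ `|chart i x - chart i (g u)| <= r.
      rewrite in_itv/= => /andP[au]; rewrite le_eqVlt => /predU1P[->//|ut].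
      by have [? /ltW] := Plt u au ut.
    have cht := regular_chain_sub ch (lexx a) at_ tb.
    have := @chart_displacement_le _ _ _ _ _ framedF g i m A k a t k0 cht.
    move=> /(_ (fun u utt => (tle u utt).1)).
    move=> /(_ (fun u utt => Pnear _ (tle u utt).1 (tle u utt).2)) dle.
    have {}dle : `|(chart i (g t) - chart i (g a)) *m A| <= k * L.
      rewrite -lee_fin (le_trans dle)// EFinM -(curve_integral_EFin framedF ch).
      rewrite lee_wpmul2l ?lee_fin// (curve_integral_split framedF ch (ltW at_) tb).
      by rewrite leeDl// (curve_integral_ge0 framedF).
    rewrite distrC -(subrKA (chart i (g a))) (le_lt_trans (ler_normD _ _))//.
    have H1 : `|chart i (g t) - chart i (g a)| <= C * (k * L).
      by rewrite (le_trans (CP _))// ler_pM2l.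
    have H2 : `|chart i (g a) - chart i x| < q by rewrite distrC.
    lra.
have gab t : t \in `[a, b] -> dom i (g t) /\ `|chart i x - chart i (g t)| <= r.
  rewrite in_itv/= => /andP[at_ tb].
  by have [? /ltW] := Pball t at_ tb.
have := @chart_displacement_le _ _ _ _ _ framedF g i m A k a b k0 ch.
move=> /(_ (fun u utt => (gab u utt).1)).
move=> /(_ (fun u utt => Pnear _ (gab u utt).1 (gab u utt).2)).
by rewrite (curve_integral_EFin framedF ch) -EFinM lee_fin leNgt ltL.
Qed.

End Competitors.

(** * Length of a curve *)

(** If L is below [(s + e / 4) * t], then [k * L] is at most [e / 2 * t]; this and the gap
    [e / 2 * t] between the two slopes add up to [e * t]. *)
Lemma slope_comparison (R : realFieldType) (s k t L e : R) :
  0 <= k -> 0 <= t -> 0 <= e -> k * (s + e / 4) <= e / 2 ->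
  (s - e / 4) * t <= (1 + k) * L -> (s + e / 4) * t <= L + e * t.
Proof.
move=> k0 t0 e0 ke H; have et := mulr_ge0 e0 t0.
have [sL|Ls] := leP ((s + e / 4) * t) L; first by rewrite ler_wpDr.
have kL : k * L <= k * ((s + e / 4) * t) by rewrite ler_wpM2l// ltW.
have kt : k * (s + e / 4) * t <= e / 2 * t by rewrite ler_wpM2r.
rewrite mulrA in kL; lra.
Qed.

Section Length.
Context (R : realType) (n : nat) (M : topologicalType).
Context (X : smoothManifold R n M).
Context (F : M -> 'rV[R]_n -> R).
Context (framedF : locally_framed X F).
Local Notation I := (curve_integral X F).
Implicit Types (g h : R -> M) (i : chart_index X) (x y : M).

(** With s0 the speed at t0, the arc is at most (s0 + eps/4)(t - s), the chord at least (s0 -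
    eps/4)(t - s), and the competitor at least the chord divided by 1 + k. The error is proportional
    to t - s, so it can be summed over a partition. *)
Lemma local_integral_le g c d w t0 eps : c < d ->
  {within `[c, d], continuous g} -> chart_velocity (X := X) g c d w ->
  t0 \in `[c, d] -> 0 < eps ->
  exists2 delta, 0 < delta & forall s t, c <= s -> s < t -> t <= d ->
    `|t0 - s| <= delta -> `|t0 - t| <= delta ->
    forall h p q, regular_chain X h p q -> {within `[p, q], continuous h} ->
      h p = g t -> h q = g s ->
      (I s t g <= I p q h + (eps * (t - s))%:E)%E.
Proof.
move=> cd cg wP t0cd eps0.
pose i := chart_at X (g t0); have it0 : dom i (g t0) by exact: dom_chart_at.
have [m [A [B [AB FA nearA]]]] := framedF it0.
pose s0 := piece_speed F g w t0.
have s0gt0 : 0 < s0 by exact: (piece_speed_gt0 framedF wP).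
have s0A : s0 = `|w i t0 *m A| by rewrite /s0 (piece_speedE F cd cg wP t0cd it0) FA.
(* The coordinate realizing the sup norm at t0 bounds the chord from below through the scalar mean
   value theorem. *)
have [j s0j] : exists j, `|w i t0 *m A| = `|(w i t0 *m A) 0 j|.
  by apply: mx_norm_coord; rewrite -s0A.
(* Chosen so that [k * (s0 + eps / 4)] equals [eps / 2], as [slope_comparison] requires. *)
pose k := eps / 2 / (s0 + eps / 4).
have s0e : 0 < s0 + eps / 4 by rewrite addr_gt0// divr_gt0.
have k0 : 0 < k by rewrite !divr_gt0.
have ke : k * (s0 + eps / 4) <= eps / 2 by rewrite divfK// gt_eqF.
have e0 : 0 < eps / 4 by rewrite divr_gt0.
have nearF : \forall y \near g t0, forall v,
    `|v *m A| <= (1 + k) * F y (tcoord i (chart_at X y) y v).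
  apply: filterS (nearA k k0) => y yP v; move: (yP v).
  by rewrite ler_norml => /andP[_]; rewrite lerBlDl mulrDl mul1r.
have k1 : 0 <= 1 + k by rewrite addr_ge0// ltW.
have [V Vt0 VP] := near_displacement_le framedF k1 it0 AB nearF.
have near1 : \forall u \near within `[c, d] (nbhs t0),
    V (g u) /\ dom i (g u) /\ `|s0 - piece_speed F g w u| <= eps / 4 /\
    `|w i t0 *m A - w i u *m A| <= eps / 4.
  apply: filterI; first exact: curve_near cg t0cd Vt0.
  apply: filterI; first exact: curve_near cg t0cd (nbhs_dom it0).
  apply: filterI.
    have /subspace_continuousP/(_ t0 t0cd) := piece_speed_continuous framedF cd cg wP.
    by move/cvgrPdist_le; exact.
  have [_ wt _] := wP i t0 t0cd it0.
  have FF : Filter (within `[c, d] (nbhs t0)) by exact: within_filter.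
  by have /cvgrPdist_le := @mulmxl_cvg _ _ _ FF _ _ _ _ _ A wt; exact.
have /nbhs_ballP[r /= r0 rP] := near1.
exists (r / 2); first exact: divr_gt0.
move=> s t cs st td st0 tt0.
have stP u : u \in `[s, t] -> V (g u) /\ dom i (g u) /\
    `|s0 - piece_speed F g w u| <= eps / 4 /\
    `|w i t0 *m A - w i u *m A| <= eps / 4.
  rewrite in_itv/= => /andP[su ut].
  apply: rP; last by rewrite /= in_itv/= (le_trans cs su) (le_trans ut td).
  move: st0 tt0; rewrite -ball_normE /ball_/= !ler_norml => /andP[? ?] /andP[? ?].
  by rewrite ltr_norml; apply/andP; split; lra.
move=> h p q ch hc hp hq.
have sst : s \in `[s, t] by rewrite in_itv/= lexx ltW.
have tst : t \in `[s, t] by rewrite in_itv/= lexx ltW.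
have subst : `[s, t] `<=` `[c, d] by exact: subset_segment.
have cgst := continuous_subspaceW subst cg.
have wPst := chart_velocity_sub cs td wP.
have gi u : u \in `[s, t] -> dom i (g u) by move=> /stP[_ []].
have := VP h p q ch hc; rewrite hp hq => /(_ (stP t tst).1 (stP s sst).1).
rewrite (curve_integral_EFin framedF ch) -EFinM lee_fin => dle.
set L := fine _ in dle *.
have L0 : 0 <= L by rewrite fine_ge0// (curve_integral_ge0 framedF).
have Ist : (I s t g <= ((s0 + eps / 4) * (t - s))%:E)%E.
  have ps u : u \in `[s, t] -> s0 - eps / 4 <= piece_speed F g w u <= s0 + eps / 4.
    by move=> /stP[_ [_ []]]; rewrite ler_distlC.
  by have /andP[] := integral_speed_piece_bounds framedF st cgst wPst ps.
apply: (le_trans Ist); rewrite -EFinD lee_fin.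
have ts0 : 0 <= t - s by rewrite subr_ge0 ltW.
apply: (slope_comparison (ltW k0) ts0 (ltW eps0) ke); apply: le_trans dle.
have cc u : u \in `]s, t[ ->
    is_derive u 1 (chart_coordinate g i A j) (chart_coordinate' w i A j u).
  exact: is_derive_chart_coordinate.
have [u ust cE] := MVT st cc (chart_coordinate_continuous cgst gi).
rewrite -normrN -mulNmx opprB; apply: le_trans (le_mx_norm _ 0 j).
have -> : ((chart i (g t) - chart i (g s)) *m A) 0 j =
    chart_coordinate g i A j t - chart_coordinate g i A j s.
  by rewrite mulmxBl mxE [X in _ + X = _]mxE.
rewrite cE normrM (gtr0_norm (_ : 0 < t - s)) ?subr_gt0// ler_wpM2r//.
have [_ [_ [_ wu]]] := stP u (subset_itv_oo_cc ust).
have := le_trans (le_mx_norm _ 0 j) wu; rewrite mxE [X in `|_ + X|]mxE.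
rewrite s0A s0j => H; rewrite lerBlDr -lerBlDl; apply: le_trans H.
exact: lerB_dist.
Qed.

(** [rho_dist] with an arbitrary F in place of [rho_hat]. For F equal to [rho_hat] the two are
    convertible, as are [curve_length] and [rho_length]; the final proof relies on it. *)
Definition curve_dist (W : M -> set M) x y : \bar R :=
  ereal_inf [set e | exists p q g,
    [/\ pwC1_curve X p q g, curve_in W p q g, g p = x, g q = y & e = I p q g]].

Context (W : M -> set M).

Lemma integral_le_dist_piece g c d w t0 eps : c < d ->
  {within `[c, d], continuous g} -> chart_velocity (X := X) g c d w ->
  t0 \in `[c, d] -> 0 < eps ->
  exists2 delta, 0 < delta & forall s t, c <= s -> s < t -> t <= d ->
    `|t0 - s| <= delta -> `|t0 - t| <= delta ->
    (I s t g <= curve_dist W (g t) (g s) + (eps * (t - s))%:E)%E.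
Proof.
move=> cd cg wP t0cd eps0.
have [delta delta0 deltaP] := local_integral_le cd cg wP t0cd eps0.
exists delta => // s t cs st td ds dt.
rewrite -leeBlDr//; apply: le_ereal_inf_tmp => _ [p [q [h [hpw [hc _] hp hq ->]]]].
rewrite leeBlDr//; apply: deltaP => //; exact: pwC1_curve_chain.
Qed.

(** One-sided, because at a junction only the piece on that side is controlled; delta is cut so that
    u stays in the piece of t. *)
Lemma integral_le_dist_right g a b eps : 0 < eps -> regular_chain X g a b ->
  forall t, a <= t -> t < b -> exists2 delta, 0 < delta &
    forall u, t < u -> u <= t + delta -> u <= b ->
    (I t u g <= curve_dist W (g u) (g t) + (eps * (u - t))%:E)%E.
Proof.
move=> eps0; elim=> {a b} [c d w cd cg wP t ct td|a c b ch1 IH1 ch2 IH2 t at_ tb].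
  have tcd : t \in `[c, d] by rewrite in_itv/= ct ltW.
  have [delta delta0 deltaP] := integral_le_dist_piece cd cg wP tcd eps0.
  exists delta => // u tu ud ub; apply: deltaP => //.
    by rewrite subrr normr0 ltW.
  by rewrite distrC gtr0_norm ?subr_gt0// lerBlDl.
have [tc|ct] := ltP t c; last exact: IH2.
have [delta delta0 deltaP] := IH1 t at_ tc.
exists (Num.min delta (c - t)); first by rewrite lt_min delta0 subr_gt0.
move=> u tu ud _; apply: deltaP => //.
  by rewrite (le_trans ud)// lerD2l ge_min lexx.
by rewrite (le_trans ud)// -lerBrDl ge_min lexx orbT.
Qed.

Lemma integral_le_dist_left g a b eps : 0 < eps -> regular_chain X g a b ->
  forall t, a < t -> t <= b -> exists2 delta, 0 < delta &
    forall u, a <= u -> t - delta <= u -> u < t ->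
    (I u t g <= curve_dist W (g t) (g u) + (eps * (t - u))%:E)%E.
Proof.
move=> eps0; elim=> {a b} [c d w cd cg wP t ct td|a c b ch1 IH1 ch2 IH2 t at_ tb].
  have tcd : t \in `[c, d] by rewrite in_itv/= td ltW.
  have [delta delta0 deltaP] := integral_le_dist_piece cd cg wP tcd eps0.
  exists delta => // u cu du ut; apply: deltaP => //.
    by rewrite gtr0_norm ?subr_gt0// lerBlDr -lerBlDl.
  by rewrite subrr normr0 ltW.
have [tc|ct] := leP t c; first exact: IH1.
have [delta delta0 deltaP] := IH2 t ct tb.
exists (Num.min delta (t - c)); first by rewrite lt_min delta0 subr_gt0.
move=> u _ du ut; apply: deltaP => //.
  by rewrite (le_trans _ du)// lerBrDr -lerBrDl ge_min lexx orbT.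
by rewrite (le_trans _ du)// lerD2l lerN2 ge_min lexx.
Qed.

Fixpoint polygonal_length g (a : R) (s : seq R) : \bar R :=
  if s is c :: s' then (curve_dist W (g c) (g a) + polygonal_length g c s')%E
  else 0%E.

Lemma polygonal_lengthE g (x0 a : R) s :
  (\sum_(0 <= i < size s)
    curve_dist W (g (nth x0 (a :: s) i.+1)) (g (nth x0 (a :: s) i)))%E =
  polygonal_length g a s.
Proof.
elim: s a => [|c s IH] a /=; first by rewrite big_nil.
by rewrite big_nat_recl//= -IH.
Qed.

Lemma polygonal_length_rcons g a s c : polygonal_length g a (rcons s c) =
  (polygonal_length g a s + curve_dist W (g c) (g (last a s)))%E.
Proof.
elim: s a => [|d s IH] a /=; first by rewrite adde0 add0e.
by rewrite IH addeA.
Qed.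

(** The length sums distances from the later point to the earlier one, so the competitor is
    [g (- t)] on [-b, -a], which has the same image. *)
Lemma curve_dist_le g a b : regular_chain X g a b -> curve_in W a b g ->
  (curve_dist W (g b) (g a) <= I a b g)%E.
Proof.
move=> ch [cg [x gx]]; apply: ereal_inf_lbound.
exists (- b), (- a), (g \o -%R).
have cgN := curve_opp_continuous cg.
split.
- exact: (regular_chain_pwC1 cgN (regular_chain_opp ch)).
- split; first exact: cgN.
  exists x => _ [t tab <-] /=; apply: gx; exists (- t) => //=.
  by rewrite oppr_itvcc.
- by rewrite /= opprK.
- by rewrite /= opprK.
- by rewrite (curve_integral_opp framedF ch).
Qed.

Lemma curve_in_sub g a b c d : a <= c -> d <= b -> curve_in W a b g ->
  curve_in W c d g.
Proof.
move=> ac db [cg [x gx]]; have sub := subset_segment ac db.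
split; first exact: continuous_subspaceW sub cg.
by exists x => _ [t /sub tab <-]; apply: gx; exists t.
Qed.

Lemma polygonal_length_le g a b s : regular_chain X g a b ->
  curve_in W a b g -> forall c, a <= c -> path <%R c s -> last c s <= b ->
  (polygonal_length g c s <= I c (last c s) g)%E.
Proof.
move=> ch gW; elim: s => [|d s IH] c ac /=.
  by move=> _ _; exact: (curve_integral_ge0 framedF).
move=> /andP[cd ds] lb.
have dl : d <= last d s by apply: (@itv_partition_le _ _ d _ s); split.
have chcl : regular_chain X g c (last d s).
  by apply: (regular_chain_sub ch) => //; exact: lt_le_trans dl.
rewrite (curve_integral_split framedF chcl (ltW cd) dl); apply: leeD.
  apply: curve_dist_le; first exact: (regular_chain_sub chcl).
  by apply: curve_in_sub gW => //; exact: le_trans lb.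
by apply: IH => //; rewrite (le_trans ac)// ltW.
Qed.

(** The allowance eps (t - a) is additive in t: appending a point u to a partition of [a, t] uses
    exactly the new share eps (u - t). *)
Lemma integral_le_polygonal g a b eps : regular_chain X g a b -> 0 < eps ->
  exists s, [/\ path <%R a s, last a s = b &
    (I a b g <= polygonal_length g a s + (eps * (b - a))%:E)%E].
Proof.
move=> ch eps0.
pose P t := exists s, [/\ path <%R a s, last a s = t &
    (I a t g <= polygonal_length g a s + (eps * (t - a))%:E)%E].
have ab := regular_chain_lt ch.
have extend t u : a <= t -> t < u -> u <= b -> P t ->
    (I t u g <= curve_dist W (g u) (g t) + (eps * (u - t))%:E)%E -> P u.
  move=> at_ tu ub [s [sp sl sle]] tule; exists (rcons s u).
  rewrite rcons_path sp last_rcons sl tu; split => //.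
  rewrite polygonal_length_rcons sl.
  have chu := regular_chain_sub ch (lexx a) (le_lt_trans at_ tu) ub.
  rewrite (curve_integral_split framedF chu at_ (ltW tu)).
  apply: (le_trans (leeD sle tule)).
  rewrite addeACA -EFinD; apply: leeD => //.
  by rewrite lee_fin -mulrDr [_ - _ + _]addrC subrKA.
suff : P b by [].
apply: (segment_induction (P := P) (a := a) (b := b)) => //; last exact: ltW.
(* The empty list partitions the degenerate segment [a, a], where the integral vanishes. *)
- exists [::]; split => //=; rewrite subrr mulr0 add0e.
  by rewrite /curve_integral set_itv1 integral_set1.
- move=> t at_ tb Pt.
  have [delta delta0 deltaP] := integral_le_dist_right eps0 ch at_ tb.
  exists delta => // u tu ud ub; apply: (extend t) => //; exact: deltaP.
- move=> t at_ tb Plt.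
  have [delta delta0 deltaP] := integral_le_dist_left eps0 ch at_ tb.
  pose u := Num.max a (t - delta).
  have au : a <= u by rewrite le_max lexx.
  have ut : u < t by rewrite gt_max at_ ltrBlDr ltrDl.
  apply: (extend u) => //; first exact: Plt.
  by apply: deltaP => //; rewrite le_max lexx orbT.
Qed.

Definition curve_length (a b : R) g : \bar R :=
  ereal_sup [set e | exists2 s, itv_partition a b s &
    e = (\sum_(0 <= i < size s)
           curve_dist W (g (nth b (a :: s) i.+1)) (g (nth b (a :: s) i)))%E].

Theorem curve_lengthE g a b : pwC1_curve X a b g -> curve_in W a b g ->
  curve_length a b g = I a b g.
Proof.
move=> /pwC1_curve_chain ch gW; apply/eqP; rewrite eq_le; apply/andP; split.
  apply: ge_ereal_sup => _ [s [sp /eqP sb] ->]; rewrite polygonal_lengthE.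
  by rewrite -{1}sb; apply: (polygonal_length_le ch gW) => //; rewrite sb.
apply/lee_addgt0Pr => e e0; have ab := regular_chain_lt ch.
have eps0 : 0 < e / (b - a) by rewrite divr_gt0// subr_gt0.
have [s [sp sb le_s]] := integral_le_polygonal ch eps0.
rewrite (le_trans le_s)// divfK ?subr_eq0 ?gt_eqF// leeD2r//.
apply: ereal_sup_ubound; exists s; last by rewrite polygonal_lengthE.
by split => //; exact/eqP.
Qed.

End Length.

(** * The norm of the splitting *)

Section Metric.
Context (R : realType) (n : nat) (M : topologicalType).
Context (X : smoothManifold R n M) (G : riemannianMetric X).
Implicit Types (i : chart_index X) (x y : M) (u v : 'rV[R]_n).

Lemma metricD x u v u' : metric G x (u + v) u' = metric G x u u' + metric G x v u'.
Proof. by rewrite -[u in LHS]scale1r metric_linear mul1r. Qed.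

Lemma metric0 x u : metric G x 0 u = 0.
Proof. by apply: (addrI (metric G x 0 u)); rewrite -metricD !addr0. Qed.

Lemma metricZ x (c : R) u v : metric G x (c *: u) v = c * metric G x u v.
Proof. by rewrite -[c *: u]addr0 metric_linear metric0 addr0. Qed.

Lemma metric_suml x (I : finType) (c : I -> R) (u : I -> 'rV[R]_n) v :
  metric G x (\sum_p c p *: u p) v = \sum_p c p * metric G x (u p) v.
Proof.
elim/big_rec2: _ => [|p _ w _ <-]; first exact: metric0.
by rewrite metric_linear.
Qed.

Lemma metric_sum2 x (I : finType) (c : I -> R) (u : I -> 'rV[R]_n) :
  metric G x (\sum_p c p *: u p) (\sum_p c p *: u p) =
  \sum_p \sum_q c p * (c q * metric G x (u p) (u q)).
Proof.
rewrite metric_suml; apply: eq_bigr => p _.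
rewrite (Defs.metric_sym G) metric_suml mulr_sumr; apply: eq_bigr => q _.
by rewrite (Defs.metric_sym G).
Qed.

Lemma tnormZ x (c : R) v : tnorm G x (c *: v) = `|c| * tnorm G x v.
Proof.
rewrite /tnorm metricZ (Defs.metric_sym G) metricZ mulrA -expr2.
by rewrite sqrtrM ?sqr_ge0// sqrtr_sqr.
Qed.

Lemma tnorm_gt0 x v : v != 0 -> 0 < tnorm G x v.
Proof. by move=> v0; rewrite sqrtr_gt0 metric_pos. Qed.

(** Smoothness of the metric is given only for fixed coordinate vectors, so [Y y] is expanded in the
    coordinate basis of chart i and its square norm becomes a finite sum of products of convergent
    terms. *)
Lemma tnorm_cvg i x (Y : M -> 'rV[R]_n) : dom i x ->
  tcoord (chart_at X y) i y (Y y) @[y --> x]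
    --> tcoord (chart_at X x) i x (Y x) ->
  tnorm G y (Y y) @[y --> x] --> tnorm G x (Y x).
Proof.
move=> ix Yx.
pose T y v := tcoord i (chart_at X y) y v.
pose e (p : 'I_n) : 'rV[R]_n := delta_mx 0 p.
pose Z y := tcoord (chart_at X y) i y (Y y).
pose S y := \sum_p \sum_q Z y 0 p * (Z y 0 q * metric G y (T y (e p)) (T y (e q))).
have SE y : dom i y -> metric G y (Y y) (Y y) = S y.
  move=> iy; rewrite /S -(metric_sum2 y (Z y 0) (fun p => T y (e p))).
  suff -> : \sum_p Z y 0 p *: T y (e p) = Y y by [].
  rewrite -[RHS](tcoordK _ (dom_chart_at X y) iy) -/(Z y) [in RHS](row_sum_delta (Z y)).
  rewrite tcoord_sum; apply: eq_bigr => p _; rewrite tcoordZ.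
  by congr (_ *: _); rewrite /T /e; congr tcoord; apply: ord1.
apply: (@continuous_cvg _ _ _ _ _ _ (@Num.sqrt R)); first exact: sqrt_continuous.
rewrite (SE _ ix).
have : S y @[y --> x] --> S x.
  have Zp p : Z y 0 p @[y --> x] --> Z x 0 p.
    apply: (@continuous_cvg _ _ _ _ _ _ (fun B : 'M[R]_(1, n) => B 0 p)) => //.
    exact: coord_continuous.
  have gpq p q : metric G y (T y (e p)) (T y (e q)) @[y --> x] -->
      metric G x (T x (e p)) (T x (e q)).
    pose phi z : R := metric G (chart_inv i z) (T (chart_inv i z) (e p))
      (T (chart_inv i z) (e q)).
    have phiE y : dom i y -> phi (chart i y) = metric G y (T y (e p)) (T y (e q)).
      by move=> iy; rewrite /phi (chartK iy).
    have cphi : {for chart i x, continuous phi}.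
      by apply: (metric_smooth G i (e p) (e q) 0%N); exists x.
    rewrite -(phiE _ ix).
    have : phi (chart i y) @[y --> x] --> phi (chart i x).
      exact: (cvg_comp _ _ (chart_cvg ix) cphi).
    apply: cvg_trans; apply: near_eq_cvg.
    by apply: filterS (nbhs_dom ix) => y iy; rewrite phiE.
  apply: cvg_big => [|p _]; first by move=> z; exact: add_continuous.
  apply: cvg_big => [|q _]; first by move=> z; exact: add_continuous.
  by apply: cvgM => //; apply: cvgM.
apply: cvg_trans; apply: near_eq_cvg; near=> y; rewrite SE//.
by near: y; exact: nbhs_dom.
Unshelve. all: by end_near. Qed.

End Metric.

Lemma matrix_cvg (R : realType) (T : Type) (F : set_system T) {FF : Filter F}
    (m n : nat) (f : T -> 'M[R]_(m, n)) (A : 'M[R]_(m, n)) :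
  (forall i, row i (f x) @[x --> F] --> row i A) -> f @ F --> A.
Proof.
move=> fA; apply/cvgrPdist_le => e e0.
have rows : \forall x \near F, forall i, `|row i A - row i (f x)| <= e.
  by apply: filter_forall => i; have /cvgrPdist_le := fA i; exact.
apply: filterS rows => x rows; apply/(mx_norm_leP _ (ltW e0)) => i j.
have := le_trans (le_mx_norm _ 0 j) (rows i).
by rewrite !mxE.
Qed.

Lemma powR_le1 (R : realType) (x r : R) : 0 <= x -> 0 < r ->
  (x `^ r <= 1) = (x <= 1).
Proof.
move=> x0 r0; have E : (1 : R) `^ r = 1 by rewrite powR1.
apply/idP/idP => [|x1].
  apply: contraTT; rewrite -!ltNge => x1; rewrite -[X in X < _]E.
  by apply: gt0_ltr_powR; rewrite ?nnegrE.
by rewrite -[leRHS]E; apply: ge0_ler_powR; rewrite ?nnegrE// ltW.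
Qed.

(** * Unit frames of the splitting *)

Section Frames.
Context (R : realType) (n : nat) (M : topologicalType).
Context (X : smoothManifold R n M) (G : riemannianMetric X) (k l : nat).
Context (Es : 'I_k -> M -> {vspace 'rV[R]_n}).
Context (Eu : 'I_l -> M -> {vspace 'rV[R]_n}).
Context (a : 'I_k -> R) (b : 'I_l -> R).
Context (a01 : forall i, 0 < `|a i| < 1) (b1 : forall j, 1 < `|b j|).

Lemma normVa_gt1 i : 1 < `|(a i)^-1|.
Proof. by have /andP[a0 a1] := a01 i; rewrite normfV invf_gt1. Qed.

Lemma exponent_s_gt0 i : 0 < ln (lambda a b) / ln `|(a i)^-1|.
Proof.
apply: divr_gt0; apply: ln_gt0; last exact: normVa_gt1.
rewrite (lt_le_trans (normVa_gt1 i))// le_max; apply/orP; left.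
exact: (le_bigmax _ (fun i => `|(a i)^-1|)).
Qed.

Lemma exponent_u_gt0 j : 0 < ln (lambda a b) / ln `|b j|.
Proof.
apply: divr_gt0; apply: ln_gt0; last exact: b1.
rewrite (lt_le_trans (b1 j))// le_max; apply/orP; right.
exact: (le_bigmax _ (fun j => `|b j|)).
Qed.

(** Such a B is invertible, but k + l and n are equal only by a proof, so B is not square by type;
    hence the two rank conditions, and [pinvmx] for the inverse. *)
Definition unit_frame x (B : 'M[R]_(k + l, n)) : Prop :=
  [/\ row_free B, row_full B,
      forall i, Es i x = <[row (lshift l i) B]>%VS,
      forall j, Eu j x = <[row (rshift k j) B]>%VS &
      forall m, tnorm G x (row m B) = 1].

(** [components] is a choice: c itself shows that a decomposition exists, and freeness of the rows
    that it is unique. *)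
Lemma components_frame x B (c : 'rV[R]_(k + l)) : unit_frame x B ->
  (forall i, (components Es Eu x (c *m B)).1 i = c 0 (lshift l i) *: row (lshift l i) B) /\
  (forall j, (components Es Eu x (c *m B)).2 j = c 0 (rshift k j) *: row (rshift k j) B).
Proof.
move=> [freeB fullB EsB EuB _]; rewrite /components.
set S := (S in xget _ S); set z := xget _ S.
have [z1 z2 zE] : S z.
  apply: xgetPex.
  exists (fun i => c 0 (lshift l i) *: row (lshift l i) B,
          fun j => c 0 (rshift k j) *: row (rshift k j) B); split => /=.
  - by move=> i; rewrite EsB; apply/vlineP; exists (c 0 (lshift l i)).
  - by move=> j; rewrite EuB; apply/vlineP; exists (c 0 (rshift k j)).
  - by rewrite mulmx_sum_row big_split_ord.
have /choice[s sE] : forall i, exists t, z.1 i = t *: row (lshift l i) B.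
  by move=> i; apply/vlineP; rewrite -EsB.
have /choice[u uE] : forall j, exists t, z.2 j = t *: row (rshift k j) B.
  by move=> j; apply/vlineP; rewrite -EuB.
have cE : c = row_mx (\row_i s i) (\row_j u j).
  apply: (row_free_inj freeB); rewrite zE [in RHS]mulmx_sum_row big_split_ord/=.
  congr (_ + _); apply: eq_bigr => i _.
    by rewrite row_mxEl mxE sE.
  by rewrite row_mxEr mxE uE.
split=> i; first by rewrite sE cE row_mxEl mxE.
by rewrite uE cE row_mxEr mxE.
Qed.

Lemma rho_le1_frame x B c : unit_frame x B ->
  (rho G Es Eu a b x (c *m B) <= 1) = (`|c| <= 1).
Proof.
move=> fB; have [cs cu] := components_frame c fB.
have [_ _ _ _ B1] := fB.
have tn m : tnorm G x (c 0 m *: row m B) = `|c 0 m| by rewrite tnormZ B1 mulr1.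
rewrite /rho ge_max; apply/andP/idP => [[/bigmax_leP[_ Hs] /bigmax_leP[_ Hu]]|c1].
  apply/(mx_norm_leP _ ler01) => o m; rewrite (ord1 o).
  rewrite -(splitK m); case: (fintype.split m) => [i|j] /=.
    by rewrite -(powR_le1 _ (exponent_s_gt0 i))// -tn -cs Hs.
  by rewrite -(powR_le1 _ (exponent_u_gt0 j))// -tn -cu Hu.
have c1' m : `|c 0 m| <= 1 by exact: le_trans (le_mx_norm _ _ _) c1.
split; apply/bigmax_leP; split => // i _.
  by rewrite cs tn powR_le1// exponent_s_gt0.
by rewrite cu tn powR_le1// exponent_u_gt0.
Qed.

(* The exponents log(lambda)/log|a_i^-1|, log(lambda)/log|b_j| are positive, so
   they do not affect the unit ball of rho, and rho_hat is just the maximum of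
   the norms of the components. *)
Lemma rho_hat_frame x B c : unit_frame x B ->
  rho_hat G Es Eu a b x (c *m B) = `|c|.
Proof.
move=> fB; rewrite /rho_hat.
have -> : [set mu | 0 < mu /\ rho G Es Eu a b x (mu^-1 *: (c *m B)) <= 1] =
    [set mu | 0 < mu /\ `|c| <= mu].
  apply/seteqP; split=> mu /= [mu0]; rewrite scalemxAl (rho_le1_frame _ fB);
    by rewrite normrZ normfV (gtr0_norm mu0) mulrC ler_pdivrMr// mul1r.
(* For c = 0 the constraint [0 < mu] is the active one, and the infimum 0 is not attained. *)
have [c0|c0] := ltP 0 `|c|.
  have -> : [set mu | 0 < mu /\ `|c| <= mu] = `[`|c|, +oo[%classic.
    apply/seteqP; split=> mu /=; rewrite in_itv/= andbT; first by case.
    by move=> cmu; split => //; exact: lt_le_trans cmu.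
  by rewrite inf_itv.
have -> : `|c| = 0 by apply/eqP; rewrite eq_le c0 normr_ge0.
have -> : [set mu : R | 0 < mu /\ 0 <= mu] = `]0, +oo[%classic.
  apply/seteqP; split=> mu /=; rewrite in_itv/= andbT; first by case.
  by move=> mu0; split => //; exact: ltW.
by rewrite inf_itv.
Qed.

Context (lineEs : forall i, continuous_line_bundle X (Es i)).
Context (lineEu : forall j, continuous_line_bundle X (Eu j)).
Context (span : forall x,
  (\sum_(i < k) Es i x + \sum_(j < l) Eu j x)%VS = fullv).
Context (direct : forall x,
  ((\sum_(i < k) Es i x) :&: (\sum_(j < l) Eu j x) = 0)%VS /\
  directv (\sum_(i < k) Es i x) /\ directv (\sum_(j < l) Eu j x)).

(** A dimension count in one tangent space; the point x is an argument since the type M alone does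
    not provide one. *)
Lemma rank_splitting (x : M) : (k + l)%N = n.
Proof.
have [d1 [/directvP d2 /directvP d3]] := direct x.
have := dimv_disjoint_sum d1; rewrite span dimvf dim_matrix mul1r d2 d3 /=.
under eq_bigr do rewrite (lineEs _).1.
under [in X in _ = (_ + X)%R]eq_bigr do rewrite (lineEu _).1.
by rewrite !sum1_card !card_ord => ->.
Qed.

Lemma unit_frame_full x (B : 'M[R]_(k + l, n)) :
  (forall i, Es i x = <[row (lshift l i) B]>%VS) ->
  (forall j, Eu j x = <[row (rshift k j) B]>%VS) ->
  (forall m, tnorm G x (row m B) = 1) -> unit_frame x B.
Proof.
move=> EsB EuB B1.
have fullB : row_full B.
  rewrite -sub1mx; apply/row_subP => o; apply/submxP.
  have : row o 1%:M \in (\sum_(i < k) Es i x + \sum_(j < l) Eu j x)%VS.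
    by rewrite span memvf.
  move=> /memv_addP[u1 /memv_sumP[us usE ->] [u2 /memv_sumP[uu uuE ->] ->]].
  have /choice[s sE] : forall i, exists t, us i = t *: row (lshift l i) B.
    by move=> i; apply/vlineP; rewrite -EsB usE.
  have /choice[u uE] : forall j, exists t, uu j = t *: row (rshift k j) B.
    by move=> j; apply/vlineP; rewrite -EuB uuE.
  exists (row_mx (\row_i s i) (\row_j u j)).
  rewrite [in RHS]mulmx_sum_row big_split_ord/=; congr (_ + _).
    by apply: eq_bigr => i _; rewrite row_mxEl mxE sE.
  by apply: eq_bigr => i _; rewrite row_mxEr mxE uE.
by split => //; apply/eqP; rewrite (eqP fullB) (rank_splitting x).
Qed.

(* [B y] consists of continuous local sections of the line bundles, normalized
   and read in the chart i. *)
Lemma local_unit_frame i x : dom i x -> exists2 B : M -> 'M[R]_(k + l, n),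
  B @ x --> B x & \forall y \near x, exists2 B', unit_frame y B' &
    forall c, tcoord i (chart_at X y) y (c *m B y) = c *m B'.
Proof.
move=> ix.
pose E (m : 'I_(k + l)) : M -> {vspace 'rV[R]_n} :=
  match fintype.split m with inl s => Es s | inr u => Eu u end.
have lineE m : continuous_line_bundle X (E m).
  by rewrite /E; case: fintype.split => [s|u]; [exact: lineEs | exact: lineEu].
have /choice[Y YP] : forall m, exists Y : M -> 'rV[R]_n,
    (tcoord (chart_at X y) i y (Y y) @[y --> x] --> tcoord (chart_at X x) i x (Y x))
    /\ \forall y \near x, E m y = <[Y y]>%VS.
  move=> m; have [_ /(_ x)[U [[oU Ux] [Y [cY YE]]]]] := lineE m.
  exists Y; split; last first.
    by apply: (@filterS _ (nbhs x) _ U _ YE); exact: open_nbhs_nbhs.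
  have := cY i; rewrite continuous_open_subspace; last first.
    by apply: openI => //; exact: dom_open.
  by move=> /(_ x); apply; rewrite inE.
have Y0 m y : E m y = <[Y m y]>%VS -> 0 < tnorm G y (Y m y).
  move=> EY; apply: tnorm_gt0; have := (lineE m).1 y.
  by rewrite EY dim_vline; case: eqP.
pose e m y := (tnorm G y (Y m y))^-1 *: Y m y.
pose B y : 'M[R]_(k + l, n) := \matrix_m tcoord (chart_at X y) i y (e m y).
exists B.
  apply: matrix_cvg => m; have [Yx /nbhs_singleton EY] := YP m.
  under eq_fun do rewrite rowK tcoordZ.
  rewrite rowK tcoordZ; apply: cvgZ => //.
  apply: cvgV; first by rewrite gt_eqF// Y0.
  exact: tnorm_cvg ix Yx.
have nearE : \forall y \near x, forall m, E m y = <[Y m y]>%VS.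
  by apply: filter_forall => m; have [] := YP m.
near=> y.
have iy : dom i y by near: y; exact: nbhs_dom.
have EY m : E m y = <[Y m y]>%VS by move: m; near: y.
(* The same unit vectors as in [B y], in the coordinates of the preferred chart at y. *)
exists (\matrix_m e m y).
  have eE m : E m y = <[row m (\matrix_m e m y)]>%VS.
    rewrite rowK EY; apply/eqP; rewrite eqEsubv -!memvE; apply/andP; split.
      apply/vlineP; exists (tnorm G y (Y m y)).
      by rewrite scalerA divff ?scale1r// gt_eqF// Y0.
    by apply/vlineP; exists (tnorm G y (Y m y))^-1.
  apply: unit_frame_full.
  - by move=> s; rewrite -eE /E (unsplitK (inl s)).
  - by move=> u; rewrite -eE /E (unsplitK (inr u)).
  - move=> m; rewrite rowK tnormZ ger0_norm ?invr_ge0 ?ltW ?Y0//.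
    by rewrite mulVf// gt_eqF// Y0.
move=> c; rewrite !mulmx_sum_row tcoord_sum; apply: eq_bigr => m _.
by rewrite tcoordZ !rowK tcoordK//; exact: dom_chart_at.
Unshelve. all: by end_near. Qed.

(** With A the inverse of [B x], a vector v = c B(y) satisfies v A - c = c (B(y) - B(x)) A, while
    [|c|] is its norm at y. The error is thus a small multiple of that norm, by continuity of B at
    x. *)
Lemma rho_hat_framed : locally_framed X (rho_hat G Es Eu a b).
Proof.
move=> i x ix; have [B Bx nearB] := local_unit_frame ix.
have BP y B' : dom i y -> unit_frame y B' ->
    (forall c, tcoord i (chart_at X y) y (c *m B y) = c *m B') ->
    forall v, exists2 c, v = c *m B y &
      rho_hat G Es Eu a b y (tcoord i (chart_at X y) y v) = `|c|.
  move=> iy fB' TB v; have [_ fullB' _ _ _] := fB'.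
  have vE : tcoord i (chart_at X y) y v =
      (tcoord i (chart_at X y) y v *m pinvmx B') *m B'.
    by rewrite -mulmxA mulVpmx// mulmx1.
  set c := _ *m pinvmx B' in vE; exists c; last by rewrite vE (rho_hat_frame _ fB').
  have cy := dom_chart_at X y.
  by rewrite -(tcoordK v iy cy) vE -TB tcoordK.
have [B0 fB0 TB0] := nbhs_singleton nearB.
have fullB : row_full (B x).
  rewrite -sub1mx; apply/row_subP => o; apply/submxP.
  by have [c -> _] := BP x B0 ix fB0 TB0 (row o 1%:M); exists c.
have freeB : row_free (B x) by apply/eqP; rewrite (eqP fullB) (rank_splitting x).
exists (k + l)%N, (pinvmx (B x)), (B x); split.
- exact: mulVpmx.
- move=> v; have [c -> ->] := BP x B0 ix fB0 TB0 v.
  by rewrite -mulmxA mulmxVp// mulmx1.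
move=> e e0; set A := pinvmx (B x).
(* The factors k + l and n come from the two uses of [mx_normM]. *)
pose K := (k + l)%:R * n%:R * `|A| + 1.
have K0 : 0 < K by rewrite ltr_wpDl// !mulr_ge0.
have eK : 0 < e / K by rewrite divr_gt0.
have /cvgrPdist_le/(_ _ eK) nearBx := Bx.
near=> y => v.
have iy : dom i y by near: y; exact: nbhs_dom.
have [B' fB' TB'] : exists2 B', unit_frame y B' &
    forall c, tcoord i (chart_at X y) y (c *m B y) = c *m B' by near: y.
have [c -> ->] := BP y B' iy fB' TB' v.
have By : `|B x - B y| <= e / K by near: y.
apply: (le_trans (ler_dist_dist _ _)).
have -> : c *m B y *m A - c = c *m (B y - B x) *m A.
  by rewrite mulmxBr mulmxBl -[X in _ = _ - X]mulmxA mulmxVp// mulmx1.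
apply: (le_trans (mx_normM _ _)).
apply: (@le_trans _ _ (n%:R * ((k + l)%:R * (`|c| * (e / K)) * `|A|))).
  rewrite ler_wpM2l// ler_wpM2r// (le_trans (mx_normM _ _))//.
  by rewrite ler_wpM2l// ler_wpM2l// distrC.
have -> : n%:R * ((k + l)%:R * (`|c| * (e / K)) * `|A|) =
    ((k + l)%:R * n%:R * `|A|) / K * (e * `|c|) by ring.
apply: ler_piMl; first by rewrite mulr_ge0// ltW.
by rewrite ler_pdivrMr// mul1r lerDl.
Unshelve. all: by end_near. Qed.

End Frames.

Theorem proposition4p4 (R : realType) (n : nat) (M : topologicalType)
    (X : smoothManifold R n M) (G : riemannianMetric X) (f finv : M -> M)
    (k l : nat)
    (Es : 'I_k -> M -> {vspace 'rV[R]_n}) (Eu : 'I_l -> M -> {vspace 'rV[R]_n})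
    (a : 'I_k -> R) (b : 'I_l -> R) :
  compact [set: M] -> connected [set: M] ->
  real_anosov G Es Eu a b f finv ->
  (forall (p q : R) (gamma : R -> M),
     pwC1_curve X p q gamma -> curve_in (stable_set G f) p q gamma ->
     (0 < rho_length G Es Eu a b (stable_set G f) p q gamma < +oo)%E /\
     rho_length G Es Eu a b (stable_set G f) p q gamma =
       curve_integral X (rho_hat G Es Eu a b) p q gamma) /\
  (forall (p q : R) (eta : R -> M),
     pwC1_curve X p q eta -> curve_in (unstable_set G finv) p q eta ->
     (0 < rho_length G Es Eu a b (unstable_set G finv) p q eta < +oo)%E /\
     rho_length G Es Eu a b (unstable_set G finv) p q eta =
       curve_integral X (rho_hat G Es Eu a b) p q eta).
Proof.
move=> _ _ [[_ _ span _] direct [lineEs lineEu] [a01 b1 _ _] _].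
have framed : locally_framed X (rho_hat G Es Eu a b).
  apply: rho_hat_framed => //.
  - by move=> i; have [] := lineEs i.
  - by move=> j; have [] := lineEu j.
  - by move=> x; have [] := span x.
  - move=> x; have [_ /directv_addP d] := span x; split; first exact: d.
    exact: direct.
have lengthP W p q (g : R -> M) : pwC1_curve X p q g -> curve_in W p q g ->
    (0 < rho_length G Es Eu a b W p q g < +oo)%E /\
    rho_length G Es Eu a b W p q g =
      curve_integral X (rho_hat G Es Eu a b) p q g.
  move=> hg gW; have E := curve_lengthE framed hg gW.
  rewrite -[rho_length _ _ _ _ _ _ _ _ _]/(curve_length X (rho_hat G Es Eu a b) W p q g).
  by rewrite E; split => //; exact: (curve_integral_fin framed (pwC1_curve_chain hg)).
by split=> p q g; exact: lengthP.
Qed.
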